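(* $\mathrm{ind}(\mathrm{susp}(X_{2h}))=3$.
   Context: A $\mathbb{Z}_2$-space is a pair $(X,\nu)$ with $\nu:X\to X$ a homeomorphism with $\nu^2=\mathrm{id}$; a $\mathbb{Z}_2$-map is a continuous map commuting with the involutions. The sphere $S^n$ carries the antipodal involution $x\mapsto -x$. The $\mathbb{Z}_2$-index of $X$ is $\mathrm{ind}(X)=\min\{n\ge 0:\text{there is a }\mathbb{Z}_2\text{-map }X\to S^n\}$. The suspension $\mathrm{susp}(X)$ is the join of $X$ with two points (the apexes), with the involution that acts as $\nu$ on $X$ and interchanges the two apexes. Let $h:S^3\to S^2$ be the Hopf map: with $S^3$ the unit sphere of $\mathbb{C}^2$ and $S^2=\mathbb{C}\mathbb{P}^1$, $h(z_1,z_2)=[z_1,z_2]$; it generates $\pi_3(S^2)\cong\mathbb{Z}$. Let $2h:S^3\to S^2$ denote a chosen map representing twice the class of $h$ in $\pi_3(S^2)$, and let $-2h$ denote the map $x\mapsto -(2h(x))$ ($2h$ followed by the antipodal map of $S^2$). The $\mathbb{Z}_2$-space $X_{2h}=S^2\cup_{2h}B^4\cup_{-2h}B^4$ is obtained from $S^2$ by attaching two $4$-cells along their boundary $S^3$ via $2h$ and $-2h$, respectively. The $\mathbb{Z}_2$-action on $X_{2h}$ is the antipodal map on $S^2$ and interchanges the two $4$-cells (a point of one copy of $B^4$ goes to the same point of the other copy). *)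

(* Defs.v *)
From HB Require Import structures.
From Stdlib Require Import Relation_Operators.
From mathcomp Require Import all_boot all_order all_algebra generic_quotient.
From mathcomp Require Import all_classical all_reals all_analysis.
From mathcomp Require Import complex ring lra.

Set Implicit Arguments.
Unset Strict Implicit.
Unset Printing Implicit Defensive.

Import Order.TTheory GRing.Theory Num.Theory.
Import numFieldTopology.Exports numFieldNormedType.Exports.

Local Open Scope classical_set_scope.
Local Open Scope ring_scope.

Section GeneratedQuotient.
Local Open Scope quotient_scope.
Variables (T : topologicalType) (r : T -> T -> Prop).

Definition gen_rel (x y : T) : bool := `[< clos_refl_sym_trans T r x y >].

Lemma gen_rel_refl : reflexive gen_rel.
Proof. by move=> x; apply/asboolP; exact: rst_refl. Qed.

Lemma gen_rel_sym : symmetric gen_rel.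
Proof.
by move=> x y; apply/idP/idP => /asboolP xy; apply/asboolP; exact: rst_sym.
Qed.

Lemma gen_rel_trans : transitive gen_rel.
Proof.
move=> y x z /asboolP xy /asboolP yz; apply/asboolP.
exact: rst_trans xy yz.
Qed.

Definition gen_equiv := EquivRel _ gen_rel_refl gen_rel_sym gen_rel_trans.

(* The quotient of T by the equivalence relation generated by r, with the
   quotient topology. *)
Definition gquot := {eq_quot gen_equiv}.

HB.instance Definition _ := Topological.copy gquot (quotient_topology gquot).
HB.instance Definition _ := Quotient.on gquot.

Lemma gquot_eq (x y : T) : r x y -> \pi_gquot x = \pi_gquot y.
Proof. by move=> xy; apply/eqmodP/asboolP; exact: rst_step. Qed.

Lemma gquot_ind (Z : Type) (f : T -> Z) :
  (forall x y, r x y -> f x = f y) ->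
  forall x y, \pi_gquot x = \pi_gquot y -> f x = f y.
Proof.
move=> rf x y /eqmodP/asboolP; elim=> {x y} //.
- by move=> x y z _ -> _ ->.
Qed.

Definition gquot_map (nu : T -> T) : gquot -> gquot :=
  fun x => \pi_gquot (nu (repr x)).

Lemma gquot_mapE (nu : T -> T) :
  (forall x y, r x y -> r (nu x) (nu y)) ->
  forall x, gquot_map nu (\pi_gquot x) = \pi_gquot (nu x).
Proof.
move=> rnu x.
apply: (@gquot_ind _ (fun x => \pi_gquot (nu x))); last by rewrite reprK.
by move=> a b /rnu; exact: gquot_eq.
Qed.

Lemma gquot_map_continuous (nu : T -> T) :
  (forall x y, r x y -> r (nu x) (nu y)) ->
  continuous nu -> continuous (gquot_map nu).
Proof.
move=> rnu cnu; apply/(@quotient_continuous _ gquot) => x.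
rewrite (_ : _ \o _ = \pi_gquot \o nu); last first.
  by apply/funext => y /=; exact: gquot_mapE.
apply: continuous_comp; first exact: cnu.
exact: (@pi_continuous _ gquot).
Qed.

Lemma gquot_mapK (nu : T -> T) :
  (forall x y, r x y -> r (nu x) (nu y)) ->
  involutive nu -> involutive (gquot_map nu).
Proof.
move=> rnu nuK x.
have -> : x = \pi_gquot (repr x) by rewrite reprK.
by rewrite !(gquot_mapE rnu) nuK.
Qed.

End GeneratedQuotient.

Record Z2space := {
  z2_carrier :> topologicalType;
  z2_inv : z2_carrier -> z2_carrier;
  z2_inv_continuous : continuous z2_inv;
  z2_invK : involutive z2_inv }.

Definition Z2map (X Y : Z2space) (g : X -> Y) : Prop :=
  continuous g /\ forall x, g (z2_inv x) = z2_inv (g x).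

Section Spheres.
Variable R : realType.

Definition sphere_set (n : nat) : set 'rV[R]_n.+1 :=
  [set x | \sum_i x ord0 i ^+ 2 = 1].
Arguments sphere_set n : clear implicits.

Definition Sphere (n : nat) : topologicalType := set_type (sphere_set n).

(* Disk n is the n-ball, with boundary Sphere n.-1. *)
Definition Disk (n : nat) : topologicalType :=
  set_type [set x : 'rV[R]_n | \sum_i x ord0 i ^+ 2 <= 1].

Lemma sphere_in_disk n (x : Sphere n) :
  val x \in [set x : 'rV[R]_n.+1 | \sum_i x ord0 i ^+ 2 <= 1].
Proof. by apply/mem_set => /=; case: x => x /= /set_mem ->. Qed.

Definition sphere_disk n (x : Sphere n) : Disk n.+1 :=
  exist _ (val x) (sphere_in_disk x).

Lemma antipode_in n (x : Sphere n) : - val x \in sphere_set n.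
Proof.
apply/mem_set; apply: etrans (set_mem (valP x)).
by apply: eq_bigr => i _; rewrite mxE sqrrN.
Qed.

Definition antipode n (x : Sphere n) : Sphere n :=
  exist _ (- val x) (antipode_in x).

Lemma antipode_continuous n : continuous (@antipode n).
Proof.
apply/continuousP => A [B oB <-].
exists ((fun v : 'rV[R]_n.+1 => - v) @^-1` B) => //.
by apply: open_comp => // v _; exact: opp_continuous.
Qed.

Lemma antipodeK n : involutive (@antipode n).
Proof. by move=> x; apply: val_inj => /=; rewrite opprK. Qed.

Definition Sphere_Z2 (n : nat) : Z2space :=
  Build_Z2space (@antipode_continuous n) (@antipodeK n).

(* None encodes an infinite index: no Z2-map from X to any sphere. *)
Definition z2_index (X : Z2space) : option nat :=
  if pselect (exists n, `[< exists g : X -> Sphere_Z2 n, Z2map g >])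
  is left exn then Some (ex_minn exn) else None.

Definition Interval : topologicalType := set_type (`[0, 1] : set R).

Section Join.
Variables X Y : Z2space.

Definition join_rel (p q : X * Y * Interval) : Prop :=
  [/\ val p.2 = 0, val q.2 = 0 & p.1.1 = q.1.1] \/
  [/\ val p.2 = 1, val q.2 = 1 & p.1.2 = q.1.2].

Definition join_inv (p : X * Y * Interval) : X * Y * Interval :=
  (z2_inv p.1.1, z2_inv p.1.2, p.2).

Lemma join_inv_rel p q : join_rel p q -> join_rel (join_inv p) (join_inv q).
Proof.
by case=> -[p0 q0 pq]; [left|right]; split=> //=; rewrite pq.
Qed.

Lemma join_inv_continuous : continuous join_inv.
Proof.
have c1 : continuous (fun p : X * Y * Interval => z2_inv p.1.1).
  move=> p; apply: (@continuous_comp _ _ _ (fst \o fst) (@z2_inv X)).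
    by apply: continuous_comp; exact: cvg_fst.
  exact: z2_inv_continuous.
have c2 : continuous (fun p : X * Y * Interval => z2_inv p.1.2).
  move=> p; apply: (@continuous_comp _ _ _ (snd \o fst) (@z2_inv Y)).
    by apply: continuous_comp; [exact: cvg_fst|exact: cvg_snd].
  exact: z2_inv_continuous.
move=> p; exact: (cvg_pair (cvg_pair (c1 p) (c2 p)) cvg_snd).
Qed.

Lemma join_invK : involutive join_inv.
Proof. by move=> [[x y] t]; rewrite /join_inv /= !z2_invK. Qed.

(* For nonempty X and Y: X * Y * [0, 1] with Y collapsed at time 0 and X
   collapsed at time 1, and the diagonal involution. *)
Definition join : Z2space := @Build_Z2space (gquot join_rel) (gquot_map join_inv)
  (gquot_map_continuous join_inv_rel join_inv_continuous)
  (gquot_mapK join_inv_rel join_invK).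

End Join.

Lemma negb_continuous : continuous negb.
Proof. by apply/continuousP => A _; exact: discrete_open. Qed.

Definition two_points : Z2space := Build_Z2space negb_continuous negbK.

Definition susp (X : Z2space) : Z2space := join X two_points.

Section TwoCells.
Variable f : Sphere 3 -> Sphere 2.

Definition piece (i : option bool) : topologicalType :=
  if i is Some _ then Disk 4 else Sphere 2.

Definition attaching_map (b : bool) (x : Sphere 3) : Sphere 2 :=
  if b then antipode (f x) else f x.

Definition attach_rel (p q : {i & piece i}) : Prop :=
  exists (b : bool) (x : Sphere 3),
    p = existT piece (Some b) (sphere_disk x) /\
    q = existT piece None (attaching_map b x).

Definition piece_inv (p : {i & piece i}) : {i & piece i} :=
  match p with
  | existT None y => existT piece None (antipode y)
  | existT (Some b) z => existT piece (Some (~~ b)) z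
  end.

Lemma piece_inv_rel p q : attach_rel p q -> attach_rel (piece_inv p) (piece_inv q).
Proof.
move=> [b [x [-> ->]]]; exists (~~ b), x; split=> //=.
by rewrite /attaching_map; case: b => //=; rewrite antipodeK.
Qed.

Lemma piece_inv_continuous : continuous piece_inv.
Proof.
case=> -[b|] x.
  by move=> U; exact: (@existT_continuous _ piece (Some (~~ b)) x).
move=> U; exact: (@continuous_comp _ _ _ (@antipode 2) (existT piece None) x
  (@antipode_continuous 2 x) (@existT_continuous _ piece None (antipode x)) U).
Qed.

Lemma piece_invK : involutive piece_inv.
Proof. by case=> -[b|] x /=; rewrite ?negbK ?antipodeK. Qed.

Definition two_cell_space : Z2space :=
  @Build_Z2space (gquot attach_rel) (gquot_map piece_inv)
  (gquot_map_continuous piece_inv_rel piece_inv_continuous)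
  (gquot_mapK piece_inv_rel piece_invK).

End TwoCells.

Section Hopf.
Local Open Scope complex_scope.

Definition z1 (x : Sphere 3) : R[i] :=
  val x ord0 (inord 0) +i* val x ord0 (inord 1).
Definition z2 (x : Sphere 3) : R[i] :=
  val x ord0 (inord 2) +i* val x ord0 (inord 3).

Definition hopf_vec (z w : R[i]) : 'rV[R]_3 :=
  \row_(j < 3) [:: 2 * complex.Re (z * w^*); 2 * complex.Im (z * w^*);
     complex.Re (z * z^*) - complex.Re (w * w^*)]`_j.

Lemma sum_sqr4 (v : 'rV[R]_4) : \sum_i v ord0 i ^+ 2 =
  v ord0 (inord 0) ^+ 2 + v ord0 (inord 1) ^+ 2 +
  v ord0 (inord 2) ^+ 2 + v ord0 (inord 3) ^+ 2.
Proof.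
rewrite !big_ord_recl big_ord0 addr0 !addrA.
by do !congr (_ + _); congr (v _ _ ^+ 2); apply: val_inj; rewrite /= inordK.
Qed.

Lemma norm_complex2 (a b c d : R) : a ^+ 2 + b ^+ 2 + c ^+ 2 + d ^+ 2 = 1 <->
  (a +i* b) * (a +i* b)^* + (c +i* d) * (c +i* d)^* = 1.
Proof.
split=> [N|/eqP]; last first.
  by rewrite eq_complex /= => /andP[/eqP N _]; rewrite -N; ring.
apply/eqP; rewrite eq_complex /=.
by apply/andP; split; apply/eqP; [rewrite -N|]; ring.
Qed.

Lemma sphere3_norm (x : Sphere 3) : z1 x * (z1 x)^* + z2 x * (z2 x)^* = 1.
Proof.
apply/norm_complex2; have /= := set_mem (valP x).
by rewrite /sphere_set /= sum_sqr4.
Qed.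

Lemma hopf_vec_in (z w : R[i]) :
  z * z^* + w * w^* = 1 -> hopf_vec z w \in sphere_set 2.
Proof.
move=> N; apply/mem_set; rewrite /sphere_set /= !big_ord_recl big_ord0 !mxE /=.
case: z w N => [a b] [c d].
move/eqP; rewrite eq_complex /= => /andP[/eqP abcd _].
transitivity ((a * a - b * - b + (c * c - d * - d)) ^+ 2); first by ring.
by rewrite abcd expr1n.
Qed.

Definition hopf_in (x : Sphere 3) := hopf_vec_in (sphere3_norm x).

(* CP^1 is identified with the unit sphere of R^3 by sending the line
   [z1 : z2] to the image of z1 / z2 under the inverse stereographic
   projection from (0, 0, 1), the line [1 : 0] going to (0, 0, 1). *)
Definition hopf (x : Sphere 3) : Sphere 2 :=
  exist _ (hopf_vec (z1 x) (z2 x)) (hopf_in x).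

Lemma hopf_vec_inj (z w z' w' : R[i]) :
  z * z^* + w * w^* = 1 -> z' * z'^* + w' * w'^* = 1 ->
  hopf_vec z w = hopf_vec z' w' ->
  [/\ z * w^* = z' * w'^*, z * z^* = z' * z'^* & w * w^* = w' * w'^*].
Proof.
case: z w z' w' => [a b] [c d] [a' b'] [c' d'].
move=> /eqP + /eqP + /rowP E; rewrite !eq_complex /=.
move=> /andP[/eqP N _] /andP[/eqP N' _].
have := E (@Ordinal 3 0 isT); have := E (@Ordinal 3 1 isT).
have := E (@Ordinal 3 2 isT); rewrite !mxE /= => E2 E1 E0.
by split; apply/eqP; rewrite eq_complex /=; apply/andP; split; apply/eqP; lra.
Qed.

(* The fibers of hopf are the traces on the sphere of the complex lines. *)
Lemma hopf_fiber (x y : Sphere 3) : hopf x = hopf y <->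
  exists l : R[i], z1 y = l * z1 x /\ z2 y = l * z2 x.
Proof.
suff main (z w z' w' : R[i]) :
    z * z^* + w * w^* = 1 -> z' * z'^* + w' * w'^* = 1 ->
    hopf_vec z w = hopf_vec z' w' <-> exists l, z' = l * z /\ w' = l * w.
  have [fwd bwd] := main _ _ _ _ (sphere3_norm x) (sphere3_norm y).
  split=> [/(congr1 val) /fwd //|/bwd E]; exact: val_inj.
move=> N N'; split=> [E|[l [z'E w'E]]].
  have [ZW ZZ WW] := hopf_vec_inj N N' E.
  have ZW' : z^* * w = z'^* * w'.
    by have := congr1 (@Num.conj _) ZW; rewrite !rmorphM /= !conjCK.
  exists (z' * z^* + w' * w^*); split.
    transitivity (z' * (z * z^*) + w' * (z * w^*)); last by ring.
    rewrite ZW; transitivity (z' * (z * z^* + w' * w'^*)); last by ring.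
    by rewrite -WW N mulr1.
  transitivity (z' * (z^* * w) + w' * (w * w^*)); last by ring.
  rewrite ZW'; transitivity (w' * (z' * z'^* + w * w^*)); last by ring.
  by rewrite -ZZ N mulr1.
have ll : l * l^* = 1.
  rewrite -N' z'E w'E !rmorphM /= -[LHS]mulr1 -N; ring.
have mulE (u v : R[i]) : l * u * (l * v)^* = u * v^*.
  rewrite rmorphM /= -[RHS]mul1r -ll; ring.
by apply/rowP => j; rewrite !mxE z'E w'E !mulE.
Qed.

End Hopf.

(* Homotopy on A, relative to B, through maps from A; the values outside A
   are irrelevant. *)
Definition homotopic_rel (T Y : topologicalType) (A B : set T) (f g : T -> Y) :=
  exists H : T * R -> Y,
    [/\ {within A `*` `[0, 1], continuous H},
        forall x, A x -> H (x, 0) = f x,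
        forall x, A x -> H (x, 1) = g x &
        forall x t, B x -> t \in `[0, 1] -> H (x, t) = f x].

Section Cubes.
Variable n : nat.

Definition cube : set 'rV[R]_n.+1 := [set t | forall i, t ord0 i \in `[0, 1]].

Definition cube_bd : set 'rV[R]_n.+1 :=
  [set t | cube t /\ exists i, t ord0 i = 0 \/ t ord0 i = 1].

(* The sum in pi_(n+1): juxtaposition along the first coordinate. *)
Definition cube_cat (Y : Type) (a b : 'rV[R]_n.+1 -> Y) (t : 'rV[R]_n.+1) : Y :=
  if t ord0 ord0 <= 2^-1
  then a (\row_i if i == ord0 then 2 * t ord0 i else t ord0 i)
  else b (\row_i if i == ord0 then 2 * t ord0 i - 1 else t ord0 i).

(* q induces a homeomorphism from cube / cube_bd onto the sphere that sends
   the collapsed boundary to s0. *)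
Definition cube_collapse (s0 : Sphere n.+1) (q : 'rV[R]_n.+1 -> Sphere n.+1) :=
  [/\ {within cube, continuous q},
      forall t, cube t -> (q t = s0 <-> cube_bd t),
      forall t u, cube t -> cube u -> ~ cube_bd t -> ~ cube_bd u ->
        q t = q u -> t = u &
      forall s, exists2 t, cube t & q t = s].

(* f is freely homotopic to a pointed map g with [g] = 2 [h] in
   pi_(n+1)(Y, h s0), elements of which are homotopy classes rel cube_bd of
   maps cube -> Y sending cube_bd to h s0; the identification q of
   cube / cube_bd with the sphere, and its orientation, are immaterial, as is
   s0.  When Y is simply connected, free and pointed homotopy classes
   coincide. *)
Definition represents_twice (Y : topologicalType) (h f : Sphere n.+1 -> Y) :=
  exists (s0 : Sphere n.+1) (q : 'rV[R]_n.+1 -> Sphere n.+1)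
         (g : Sphere n.+1 -> Y),
    [/\ cube_collapse s0 q, continuous g,
        homotopic_rel setT set0 f g,
        g s0 = h s0 &
        homotopic_rel cube cube_bd (g \o q) (cube_cat (h \o q) (h \o q))].

End Cubes.

End Spheres.

Arguments hopf {R} x.

(* Main.v *)
Require Import Defs.
From mathcomp Require Import all_boot all_order all_algebra generic_quotient.
From mathcomp Require Import all_classical all_reals all_analysis.
From mathcomp Require Import complex ring lra.
From Stdlib Require Import Btauto.

Set Implicit Arguments.
Unset Strict Implicit.
Unset Printing Implicit Defensive.


(** Lower bound.  The suspension of the space contains the suspension of its
    2-sphere, which is a 3-sphere with the antipodal involution, so that the
    index is at least 3 by the Borsuk-Ulam theorem.  In the form used here
    ([odd_not_contractible]) that theorem says that an odd map of the 2-sphere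
    to itself is not null-homotopic.  It is proved by a parity argument in the
    manner of Tucker and Fan: on a fine grid each value is replaced by a signed
    coordinate in which it is large, nearby values never get opposite labels,
    and the simplices with alternating labels are counted modulo 2
    ([grid_borsuk_ulam]).

    Upper bound.  A Z2-map from the suspension to the 3-sphere is the obvious
    identification on the suspended 2-sphere.  By symmetry it only has to be
    extended over one of the two suspended 4-cells ([susp_index_le3]), which is
    possible as soon as the suspension of the attaching map, a homotopy of maps
    into the 3-sphere with parameter an angle [th] between the two apexes, is
    homotopic, relatively to the apexes, to a map that does not depend on the
    point of the 3-sphere ([extend_to_disk]).

    Such a homotopy is written in the group of unit quaternions, the 2-sphere
    being the set of imaginary ones.  The suspension of the Hopf map [h] is
    [E x th = sin th + cos th * h x].  Let [V th] be its value at the base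
    point.  Juxtaposition in a topological group is a pointwise product, and
    therefore the suspension of twice [h] is homotopic to [E * V^-1 * E]
    ([represents_twice_hopf]).  Left multiplication by the quaternion [j]
    changes [h] into its opposite, hence [E] into [E^-1], and it is homotopic
    to the identity: the product becomes [E * V^-1 * E^-1].  Finally the angle
    in both outer factors can be moved to the top apex, where [E] is 1, which
    leaves [V^-1] ([triple_hopf_null]).  The apexes do not move in this
    homotopy because [V] is central, equal to 1 or -1, at them. *)

(** * A combinatorial Borsuk-Ulam theorem *)

Lemma xor_telescope (f : nat -> bool) (n : nat) :
  \big[addb/false]_(i < n) (f i (+) f i.+1) = f 0 (+) f n.
Proof.
elim: n => [|n IH]; first by rewrite big_ord0 addbb.
by rewrite big_ord_recr /= IH; case: (f 0) (f n) (f n.+1) => [] [] [].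
Qed.

(** A label is an index, among three, with a sign; [true] is the positive sign. *)
Definition label := (option bool * bool)%type.

Definition opp_label (l : label) : label := (l.1, ~~ l.2).

Lemma opp_labelK : involutive opp_label.
Proof. by case=> i s; rewrite /opp_label /= negbK. Qed.

(* The three indices, in increasing order, are [None], [Some false] and
   [Some true]. *)
Local Notation pos1 := (None, true).
Local Notation pos2 := (Some false, true).
Local Notation neg2 := (Some false, false).
Local Notation pos3 := (Some true, true).
Local Notation neg3 := (Some true, false).

(** [fan0], [fan1] and [fan2] recognize the vertices, edges and triangles whose
    labels, sorted by index, alternate in sign beginning with a positive one. *)
Definition fan0 (a : label) : bool := a.2.

Definition fan1 (a b : label) : bool :=
  let s := [:: a; b] in
  [|| (pos1 \in s) && (neg2 \in s), (pos1 \in s) && (neg3 \in s)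
    | (pos2 \in s) && (neg3 \in s)].

Definition fan2 (a b c : label) : bool :=
  let s := [:: a; b; c] in [&& pos1 \in s, neg2 \in s & pos3 \in s].

Definition compat (s : seq label) : bool :=
  allrel (fun a b => a != opp_label b) s s.

(** In terms of cochains modulo 2 on the complex of compatible labels, the
    coboundary of each of these counts is the next one, symmetrized under
    negation.  For [fan1]: an alternating triangle has two alternating edges,
    with opposite first signs, so that one of them counts; in a triangle with a
    repeated label or without alternation the edges that count come in pairs. *)
Lemma fan0_coboundary a b : compat [:: a; b] ->
  fan0 a (+) fan0 b = fan1 a b (+) fan1 (opp_label a) (opp_label b).
Proof. by case: a b => [[[]|] []] [[[]|] []]. Qed.

Lemma fan1_coboundary a b c : compat [:: a; b; c] ->
  fan1 a b (+) fan1 a c (+) fan1 b c =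
  fan2 a b c (+) fan2 (opp_label a) (opp_label b) (opp_label c).
Proof. by case: a b c => [[[]|] []] [[[]|] []] [[[]|] []]. Qed.

(** Four compatible labels have only three indices, so that one label is
    repeated and the alternating faces come in pairs. *)
Lemma fan2_cocycle a b c d : compat [:: a; b; c; d] ->
  fan2 a b c (+) fan2 a b d (+) fan2 a c d (+) fan2 b c d = false.
Proof. by case: a b c d => [[[]|] []] [[[]|] []] [[[]|] []] [[[]|] []]; by vm_compute. Qed.

Lemma fan1C a b : fan1 a b = fan1 b a.
Proof. by case: a b => [[[]|] []] [[[]|] []]. Qed.

Lemma fan1aa a : fan1 a a = false.
Proof. by case: a => [[[]|] []]. Qed.

Lemma fan2_swapl a b c : fan2 a b c = fan2 b a c.
Proof. by case: a b c => [[[]|] []] [[[]|] []] [[[]|] []]. Qed.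

Lemma fan2_swapr a b c : fan2 a b c = fan2 a c b.
Proof. by case: a b c => [[[]|] []] [[[]|] []] [[[]|] []]. Qed.

Lemma fan2_aab a b : fan2 a a b = false.
Proof. by case: a b => [[[]|] []] [[[]|] []]. Qed.

Lemma fan2_abb a b : fan2 a b b = false.
Proof. by case: a b => [[[]|] []] [[[]|] []]. Qed.

(** The count on a square with corners [a b] over [c d], cut into two triangles
    along the diagonal from [a] to [d]. *)
Definition fan_square (a b c d : label) : bool := fan2 a b d (+) fan2 a c d.

Lemma compat_sub s t : {subset t <= s} -> compat s -> compat t.
Proof.
move=> st /allrelP cs; apply/allrelP => a b ta tb; exact: cs (st _ ta) (st _ tb).
Qed.

Lemma compat_map (T : Type) (f : T -> label) (s : seq T) :
  (forall x y, f x != opp_label (f y)) -> compat [seq f x | x <- s].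
Proof.
move=> fs; rewrite /compat allrel_mapl allrel_mapr; rewrite /allrel.
by apply/allT => x; apply/allT => y; exact: fs.
Qed.

Lemma compat_opp s : compat s -> compat [seq opp_label l | l <- s].
Proof.
rewrite /compat allrel_mapl allrel_mapr; congr is_true; apply: eq_allrel => a b.
by rewrite (inj_eq (can_inj opp_labelK)).
Qed.

(** Both diagonals of a square give the same count: the two pairs of triangles
    bound a tetrahedron. *)
Lemma fan_square_flip a b c d : compat [:: a; b; c; d] ->
  fan_square c d a b = fan_square a b c d.
Proof.
move=> /fan2_cocycle; rewrite /fan_square.
rewrite (fan2_swapr c d b) (fan2_swapl c b d) (fan2_swapl c a b) (fan2_swapr a c b).
by do 4!case: (fan2 _ _ _).
Qed.

Lemma fan_square_boundary a b c d : compat [:: a; b; c; d] ->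
  fan_square a b c d (+) fan_square (opp_label a) (opp_label b) (opp_label c) (opp_label d) =
  fan1 a b (+) fan1 c d (+) (fan1 a c (+) fan1 b d).
Proof.
move=> abcd.
have /fan1_coboundary : compat [:: a; b; d].
  by apply: compat_sub abcd => x; rewrite !inE => /or3P[] ->; rewrite ?orbT.
have /fan1_coboundary : compat [:: a; c; d].
  by apply: compat_sub abcd => x; rewrite !inE => /or3P[] ->; rewrite ?orbT.
rewrite /fan_square; do 5!case: (fan1 _ _); by do 4!case: (fan2 _ _ _).
Qed.

(** The six faces of a cube cancel: cut the cube into the six tetrahedra
    spanned by the monotone edge paths from [x000] to [x111]; the inner
    triangles occur twice. *)
Lemma fan_cube x000 x001 x010 x011 x100 x101 x110 x111 :
  compat [:: x000; x001; x010; x011; x100; x101; x110; x111] ->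
  fan_square x000 x001 x010 x011 (+) fan_square x100 x101 x110 x111 (+)
  (fan_square x000 x001 x100 x101 (+) fan_square x010 x011 x110 x111) (+)
  (fan_square x000 x010 x100 x110 (+) fan_square x001 x011 x101 x111) = false.
Proof.
move=> cx; rewrite /fan_square.
have tet y z : y \in [:: x001; x010; x100] -> z \in [:: x011; x101; x110] ->
    fan2 x000 y z = fan2 x000 y x111 (+) fan2 x000 z x111 (+) fan2 y z x111.
  move=> ys zs; have /fan2_cocycle : compat [:: x000; y; z; x111].
    move: ys zs; rewrite !inE => ys zs.
    apply: compat_sub cx => u; rewrite !inE => /or4P[] /eqP->; rewrite ?eqxx ?orbT //.
      by case/or3P: ys => /eqP->; rewrite eqxx ?orbT.
    by case/or3P: zs => /eqP->; rewrite eqxx ?orbT.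
  by do 4!case: (fan2 _ _ _).
rewrite (tet x001 x011) ?(tet x010 x011) ?(tet x001 x101) ?(tet x100 x101);
  rewrite ?(tet x010 x110) ?(tet x100 x110) ?inE ?eqxx ?orbT //.
have addbE (a b : bool) : a (+) b = xorb a b by case: a b => [] [].
rewrite !addbE; btauto.
Qed.

(** The labels of an odd map of a sphere, contracted to a point as [k] increases.
    The sphere is the grid of the latitudes [i <= n] and of the longitudes [j]
    modulo [n + n]; antipodes are half a turn apart in longitude.

    By [fan_cube] all slices have the same count, which is 0 where the labels
    are constant.  By oddness the count of the first slice is that of half of the
    sphere, symmetrized, hence by [fan_square_boundary] the count [fan1] of the
    bounding circle.  The same argument reduces it to the two poles, which have
    opposite labels and contribute 1. *)
Lemma grid_borsuk_ulam (n : nat) (L : nat -> nat -> nat -> label) :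
  (forall i j k, i < n -> j < n + n -> k < n ->
    compat [:: L i j k; L i j k.+1; L i j.+1 k; L i j.+1 k.+1;
      L i.+1 j k; L i.+1 j k.+1; L i.+1 j.+1 k; L i.+1 j.+1 k.+1]) ->
  (forall j k, L 0 j k = L 0 0 k) ->
  (forall j k, L n j k = L n 0 k) ->
  (forall i k, L i (n + n) k = L i 0 k) ->
  (forall i j, L i j n = L 0 0 n) ->
  (forall i j, i <= n -> L i (n + j) 0 = opp_label (L (n - i) j 0)) ->
  n = 0.
Proof.
move=> Lcompat Lbot Ltop Lper Lend Lodd; case: (posnP n) => // n_gt0.
pose floor k i j := fan_square (L i j k) (L i j.+1 k) (L i.+1 j k) (L i.+1 j.+1 k).
pose slice k := \big[addb/false]_(i < n) \big[addb/false]_(j < n + n) floor k i j.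
have slice_const k : k < n -> slice k = slice k.+1.
  move=> kn.
  (* the faces of the slab that are orthogonal to the first two directions *)
  pose X i j := fan_square (L i j k) (L i j k.+1) (L i j.+1 k) (L i j.+1 k.+1).
  pose Y i j := fan_square (L i j k) (L i j k.+1) (L i.+1 j k) (L i.+1 j k.+1).
  have step i j : i < n -> j < n + n ->
      floor k i j (+) floor k.+1 i j = X i j (+) X i.+1 j (+) (Y i j (+) Y i j.+1).
    move=> ni nj; have := fan_cube (Lcompat i j k ni nj kn); rewrite /X /Y /floor.
    by do 6!case: (fan_square _ _ _ _).
  have : slice k (+) slice k.+1 = false.
    rewrite /slice -big_split.
    under eq_bigr => i _ do rewrite -big_split /=.
    under eq_bigr => i _ do under eq_bigr => j _ do rewrite step //.
    under eq_bigr => i _ do rewrite big_split /= (xor_telescope (Y i)).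
    rewrite big_split /= exchange_big /= [X in _ (+) X]big1 ?addbF.
      under eq_bigr => j _ do rewrite (xor_telescope (fun i => X i j)).
      rewrite big1 // => j _.
      by rewrite /X !(Lbot j.+1) !(Ltop j.+1) !(Lbot j) !(Ltop j)
        /fan_square !fan2_abb !fan2_aab.
    by move=> i _; rewrite /Y !Lper addbb.
  by case: (slice k) (slice k.+1) => [] [].
have slice0 : slice 0 = false.
  have -> : slice 0 = slice n.
    have : forall k, k <= n -> slice 0 = slice k.
      by elim=> // k IH kn; exact: etrans (IH (ltnW kn)) (slice_const _ kn).
    by apply.
  rewrite /slice big1 // => i _; rewrite big1 // => j _.
  rewrite /floor !(Lend i) !(Lend i.+1) /fan_square fan2_aab; by [].
have Lodd0 i : i <= n -> L i n 0 = opp_label (L (n - i) 0 0).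
  by move=> ni; rewrite -Lodd // addn0.
have : slice 0 = fan0 (L 0 0 0) (+) fan0 (L n 0 0).
  rewrite /slice.
  under eq_bigr => i _ do rewrite big_split_ord /=.
  (* the second half of the longitudes is folded on the first one, which
     reverses the latitudes *)
  rewrite big_split /= [X in _ (+) X](reindex_inj rev_ord_inj) /= -big_split /=.
  pose P i j := fan1 (L i j 0) (L i j.+1 0).
  pose Q i j := fan1 (L i j 0) (L i.+1 j 0).
  have step (i j : 'I_n) :
      floor 0 i j (+) floor 0 (n - i.+1) (n + j) =
      P i j (+) P i.+1 j (+) (Q i j (+) Q i j.+1).
    have jn : j < n + n by rewrite ltn_addr.
    have cQ : compat [:: L i j 0; L i j.+1 0; L i.+1 j 0; L i.+1 j.+1 0].
      apply: compat_sub (Lcompat i j 0 (ltn_ord i) jn n_gt0) => x.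
      by rewrite !inE => /or4P[] ->; rewrite ?orbT.
    rewrite -(fan_square_boundary cQ) /floor; congr (_ (+) _).
    have li : n - i.+1 < n by rewrite ltn_subrL n_gt0.
    rewrite -addnS !Lodd ?(ltnW li) // subnSK // subKn // subKn ?(ltnW (ltn_ord i)) //.
    by apply: fan_square_flip (compat_opp cQ).
  under eq_bigr => i _ do rewrite -big_split /=.
  under eq_bigr => i _ do under eq_bigr => j _ do rewrite step.
  under eq_bigr => i _ do rewrite big_split /= (xor_telescope (Q i)).
  rewrite big_split /= exchange_big /= [X in X (+) _]big1 ?addFb.
    rewrite -(xor_telescope (fun i => fan0 (L i 0 0))) big_split /=.
    rewrite [X in _ (+) X](reindex_inj rev_ord_inj) /= -big_split /=.
    apply: eq_bigr => i _; rewrite fan0_coboundary; last first.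
      have n2_gt0 : 0 < n + n by rewrite addn_gt0 n_gt0.
      apply: compat_sub (Lcompat i 0 0 (ltn_ord i) n2_gt0 n_gt0) => x.
      by rewrite !inE => /orP[] ->; rewrite ?orbT.
    have li : n - i.+1 < n by rewrite ltn_subrL n_gt0.
    rewrite /Q !Lodd0 ?(ltnW li) // subnSK // subKn // subKn ?(ltnW (ltn_ord i)) //.
    by rewrite [fan1 (opp_label _) _]fan1C.
  move=> j _; rewrite (xor_telescope (fun i => P i j)) /P.
  by rewrite !(Lbot j.+1) !(Ltop j.+1) !(Lbot j) !(Ltop j) !fan1aa.
rewrite slice0 -(Ltop n) Lodd0 // subnn /fan0 /=.
by case: (L 0 0 0).2.
Qed.

Import Order.TTheory GRing.Theory Num.Theory.
Import numFieldTopology.Exports numFieldNormedType.Exports.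

Local Open Scope classical_set_scope.
Local Open Scope ring_scope.

(** * The Borsuk-Ulam theorem for the 2-sphere *)

Section UniformContinuity.
Variable R : realType.

Lemma uniformly_continuous_on_compact (T V : pseudoMetricType R) (K : set T)
    (f : T -> V) (e : R) :
  compact K -> continuous f -> 0 < e ->
  exists2 d, 0 < d & forall x y, K x -> ball x d y -> ball (f x) e (f y).
Proof.
move=> /compact_near_coveringP cK cf e0.
pose P (d : R) x := forall y, ball x d y -> ball (f x) e (f y).
have : \forall d \near 0^'+, K `<=` P d.
  apply: cK => x Kx.
  have e2 : 0 < e / 2 by rewrite divr_gt0.
  have /nbhs_ballP[r /= r0 fr] : nbhs x (f @^-1` ball (f x) (e / 2)).
    by apply: cf; apply/nbhs_ballP; exists (e / 2).
  exists (ball x (r / 2), [set d | d < r / 2]); first split => /=.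
  - by apply/nbhs_ballP; exists (r / 2) => //=; rewrite divr_gt0.
  - by apply: nbhs_right_lt; rewrite divr_gt0.
  move=> [x' d] /= [xx' dr] y x'y.
  have xy : ball x r y.
    by rewrite [r]splitr; exact: ball_triangle xx' (le_ball (ltW dr) x'y).
  have xx'r : ball x r x' 
    by apply: (@le_ball _ _ _ (r / 2)) xx'; rewrite ler_pdivrMr // ler_peMr ?ltW // ltr1n.
  rewrite [e]splitr; apply: (@ball_triangle _ _ (f x)) => //.
    by apply: ball_sym; exact: fr.
  exact: fr.
move=> [d0 /= d0_gt0 PK]; exists (d0 / 2); first by rewrite divr_gt0.
move=> x y Kx xy; apply: (PK (d0 / 2)) => //=; last by rewrite divr_gt0.
by rewrite sub0r normrN gtr0_norm ?divr_gt0 // ltr_pdivrMr // ltr_pMr // ltr1n.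
Qed.

End UniformContinuity.

Section BorsukUlam.
Variable R : realType.

(** Since 3/4 < 1, a unit vector has a coordinate of absolute value at least 1/2;
    the default of the last branch is therefore never a small coordinate. *)
Definition sign_label (x : option bool -> R) : label :=
  let i := if 2^-1 <= `|x None| then None
           else if 2^-1 <= `|x (Some false)| then Some false else Some true in
  (i, 0 < x i).

Definition unit_vec3 (x : option bool -> R) :=
  x None ^+ 2 + x (Some false) ^+ 2 + x (Some true) ^+ 2 = 1.

Lemma sign_label_large x : unit_vec3 x -> 2^-1 <= `|x (sign_label x).1|.
Proof.
rewrite /unit_vec3 /sign_label /= => x1.
case: (leP 2^-1 `|x None|) => //= a; case: (leP 2^-1 `|x (Some false)|) => //= b.
rewrite leNgt; apply/negP => c.
have sq (y : R) : `|y| < 2^-1 -> y ^+ 2 < 4^-1.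
  move=> y2; rewrite -real_normK ?num_real //.
  by have := normr_ge0 y; nra.
have := sq _ a; have := sq _ b; have := sq _ c; lra.
Qed.

Lemma sign_label_opp x y : unit_vec3 x -> (forall i, y i = - x i) ->
  sign_label y = opp_label (sign_label x).
Proof.
move=> x1 yx; have := sign_label_large x1.
rewrite /sign_label /opp_label /= !yx !normrN.
set i := (if _ then _ else _) => xi; congr (_, _).
rewrite oppr_gt0; have : x i != 0.
  by apply/eqP => x0; move: xi; rewrite x0 normr0 leNgt invr_gt0 ltr0n.
by case: (ltgtP (x i) 0).
Qed.

(** Opposite labels mean values at most -1/2 and at least 1/2 of the same
    coordinate. *)
Lemma sign_label_near x y : unit_vec3 x -> unit_vec3 y ->
  (forall i, `|x i - y i| < 1) -> sign_label x != opp_label (sign_label y).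
Proof.
move=> x1 y1 xy; apply/negP => /eqP E.
have := sign_label_large x1; have := sign_label_large y1.
have i_eq : (sign_label x).1 = (sign_label y).1 by rewrite E.
have : (0 < x (sign_label x).1) = ~~ (0 < y (sign_label y).1).
  by have := congr1 snd E.
rewrite i_eq; move: (sign_label y).1 => i.
have := xy i; rewrite ltr_norml => /andP[].
case: (ltP 0 (x i)) => xi; case: (ltP 0 (y i)) => yi //= *.
- move: (gtr0_norm xi) (ler0_norm yi); lra.
- move: (gtr0_norm yi) (ler0_norm xi); lra.
Qed.

(** An odd map of the 2-sphere to itself is not null-homotopic.  Here the
    2-sphere is swept out by half circles from pole to pole: the latitude [s]
    runs from 0 to 1, the longitude [t] modulo 2, and [u] is the time of the
    homotopy. *)
Lemma odd_not_contractible (g : option bool -> R * R * R -> R) :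
  (forall c, continuous (g c)) ->
  (forall p, unit_vec3 (g^~ p)) ->
  (forall c t u, g c (0, t, u) = g c (0, 0, u)) ->
  (forall c t u, g c (1, t, u) = g c (1, 0, u)) ->
  (forall c s u, g c (s, 2, u) = g c (s, 0, u)) ->
  (forall c s t, g c (s, t, 1) = g c (0, 0, 1)) ->
  (forall c s t, g c (s, 1 + t, 0) = - g c (1 - s, t, 0)) ->
  False.
Proof.
move=> cg g1 gbot gtop gper gend godd.
pose K := `[0, 1]%classic `*` `[0, 2]%classic `*` `[0, 1]%classic : set (R * R * R).
have cK : compact K by apply: compact_setX; [apply: compact_setX|]; exact: segment_compact.
have unif c : exists2 d, 0 < d & forall x y, K x -> ball x d y -> ball (g c x) 1 (g c y).
  exact: uniformly_continuous_on_compact cK (cg c) ltr01.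
have [d d0 gd] : exists2 d, 0 < d &
    forall x y, K x -> ball x d y -> forall c, `|g c x - g c y| < 1.
  have [d1 d10 h1] := unif None; have [d2 d20 h2] := unif (Some false).
  have [d3 d30 h3] := unif (Some true).
  exists (Num.min d1 (Num.min d2 d3)); first by rewrite !lt_min d10 d20 d30.
  move=> x y Kx xy [[]|].
  - by apply: h3 => //; apply: le_ball xy; rewrite !ge_min lexx !orbT.
  - by apply: h2 => //; apply: le_ball xy; rewrite !ge_min lexx !orbT.
  - by apply: h1 => //; apply: le_ball xy; rewrite !ge_min lexx.
have [n n0 nd] : exists2 n, (0 < n)%N & n%:R^-1 < d.
  exists (Num.truncn d^-1).+1 => //.
  rewrite invf_plt ?posrE // ?ltr0n //; exact: truncnS_gt.
have nR : 0 < n%:R :> R by rewrite ltr0n.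
pose q (i : nat) : R := i%:R / n%:R.
pose L i j k := sign_label (g^~ (q i, q j, q k)).
suff : n = 0 by move=> n00; rewrite n00 in n0.
have q0 : q 0 = 0 by rewrite /q mul0r.
have qn : q n = 1 by rewrite /q divff ?gt_eqF.
have qD i j : q (i + j)%N = q i + q j by rewrite /q natrD mulrDl.
have ext (x y : option bool -> R) : x =1 y -> sign_label x = sign_label y.
  by move=> /funext ->.
apply: (@grid_borsuk_ulam n L).
- move=> i j k ni nj nk.
  have near1 (a b : R * R * R) : K a -> ball a d b ->
      sign_label (g^~ a) != opp_label (sign_label (g^~ b)).
    by move=> Ka ab; apply: sign_label_near => // c; exact: gd.
  have qball (m : nat) (e e' : bool) : ball (q (m + e)%N) d (q (m + e')%N).
    rewrite /ball /= !qD opprD addrACA subrr add0r -mulrBl normrM normfV (gtr0_norm nR).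
    apply: le_lt_trans nd; rewrite ler_piMl ?invr_ge0 ?(ltW nR) //.
    by case: e e' => [] [] /=; rewrite ?subrr ?subr0 ?sub0r ?normrN ?normr0 ?normr1 //.
  have qK (i0 b : nat) (e : bool) : (i0 < b)%N -> 0 <= q (i0 + e)%N <= b%:R / n%:R.
    move=> ib; rewrite /q; apply/andP; split; first by rewrite divr_ge0.
    rewrite ler_wpM2r ?invr_ge0 ?ler0n //.
    by rewrite ler_nat; case: e; rewrite ?addn1 ?addn0 // ltnW.
  have KE (e1 e2 e3 : bool) : K (q (i + e1)%N, q (j + e2)%N, q (k + e3)%N).
    rewrite /K /= !in_itv /=; split; first split.
    - by have := qK _ _ e1 ni; rewrite divff ?gt_eqF.
    - by have := qK _ _ e2 nj; rewrite natrD mulrDl divff ?gt_eqF.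
    - by have := qK _ _ e3 nk; rewrite divff ?gt_eqF.
  pose Lb (e : bool * bool * bool) :=
    sign_label (g^~ (q (i + e.1.1)%N, q (j + e.1.2)%N, q (k + e.2)%N)).
  suff : compat [seq Lb e | e <- [:: (false, false, false); (false, false, true);
      (false, true, false); (false, true, true); (true, false, false);
      (true, false, true); (true, true, false); (true, true, true)]].
    by rewrite [map _ _]/= /Lb /L /= !addn0 !addn1.
  apply: compat_map => e e'.
  by apply: near1; [exact: KE|split; [split|]; exact: qball].
- by move=> j k; rewrite /L; apply: ext => c; rewrite q0 gbot.
- by move=> j k; rewrite /L; apply: ext => c; rewrite qn q0 gtop.
- by move=> i k; rewrite /L; apply: ext => c; rewrite qD qn q0 gper.
- by move=> i j; rewrite /L; apply: ext => c; rewrite qn q0 gend.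
- move=> i j ni; rewrite /L; apply: sign_label_opp => // c.
  have -> : q (n - i)%N = 1 - q i by rewrite -qn -[in q n](subnK ni) qD addrK.
  by rewrite qD qn q0 godd.
Qed.

End BorsukUlam.
(** * Quotients and products of topological spaces *)

Section Topology.

Lemma hausdorff_injective (S T : topologicalType) (f : S -> T) :
  continuous f -> injective f -> hausdorff_space T -> hausdorff_space S.
Proof.
move=> cf f_inj hT p q pq; apply: f_inj; apply: hT => A B pA qB.
by have [x [fxA fxB]] := pq _ _ (cf p _ pA) (cf q _ qB); exists (f x).
Qed.

Lemma hausdorff_prod (S T : topologicalType) :
  hausdorff_space S -> hausdorff_space T -> hausdorff_space (S * T)%type.
Proof.
move=> hS hT [p1 p2] [q1 q2] pq; congr (_, _).
  apply: hS => A B pA qB.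
  have [] := pq (fst @^-1` A) (fst @^-1` B); first exact: cvg_fst.
    exact: cvg_fst.
  by move=> x [xA xB]; exists x.1.
apply: hT => A B pA qB.
have [] := pq (snd @^-1` A) (snd @^-1` B); first exact: cvg_snd.
  exact: cvg_snd.
by move=> x [xA xB]; exists x.2.
Qed.

Lemma set_type_hausdorff (T : topologicalType) (A : set T) :
  hausdorff_space T -> hausdorff_space (set_type A).
Proof.
by apply: hausdorff_injective; [exact: initial_continuous|exact: val_inj].
Qed.

Lemma set_type_compact (T : topologicalType) (A : set T) :
  compact A -> compact [set: set_type A].
Proof.
move=> cA F PF _.
have FA : (val @ F) A.
  by apply: (@filterS _ F _ setT) filterT => x _; exact: (set_mem (valP x)).
have [x [Ax xF]] := cA (val @ F) _ FA.
exists (exist _ x (mem_set Ax)); split=> // P V FP [W [[U oU <-] /= xU] UV].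
have FvP : (val @ F) (val @` P) by apply: (@filterS _ F _ P) FP => y Py; exists y.
have [_ [[y Py <-] Uy]] := xF _ _ FvP (open_nbhs_nbhs (conj oU xU)).
by exists y; split=> //; exact: UV.
Qed.

Lemma continuous_to_set_type (S T : topologicalType) (A : set T)
    (f : S -> set_type A) :
  continuous (fun x => val (f x)) -> continuous f.
Proof. exact: continuous_comp_initial. Qed.

Lemma continuous_to_rV (S T : topologicalType) (n : nat) (f : S -> 'rV[T]_n) :
  (forall j, continuous (fun x => f x ord0 j)) -> continuous f.
Proof.
move=> cf x A [P fxP sPA].
apply: (@filterS _ _ _ (fun y => forall j, P ord0 j (f y ord0 j))).
  by move=> y yP; apply: sPA => i j; rewrite (ord1 i).
apply: filter_forall => j; exact: cf (fxP ord0 j).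
Qed.

(** A continuous surjection from a compact space to a Hausdorff space is closed,
    hence a quotient map. *)
Lemma factor_through_closed (A B Z : topologicalType) (p : A -> B) (phi : A -> Z) :
  compact [set: A] -> hausdorff_space B -> continuous p -> continuous phi ->
  (forall b, exists a, p a = b) ->
  (forall a a', p a = p a' -> phi a = phi a') ->
  exists2 psi : B -> Z, continuous psi & forall a, psi (p a) = phi a.
Proof.
move=> cA hB cp cphi psurj pphi.
have [s ps] := choice psurj.
have psiE a : phi (s (p a)) = phi a by apply: pphi; rewrite ps.
exists (phi \o s) => //; apply/continuous_closedP => C cC.
have -> : (phi \o s) @^-1` C = p @` (phi @^-1` C).
  apply/seteqP; split=> [b Cb|_ [a Ca <-]] /=; first by exists (s b).
  by rewrite psiE.
apply: compact_closed => //; apply: continuous_compact.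
  exact: continuous_subspaceT.
apply: subclosed_compact cA _ => //.
by move/continuous_closedP : cphi; apply.
Qed.

(** The product of a quotient map with a compact space is a quotient map; this is
    the exponential law, and the next lemma applies it to the two-cell space. *)
Lemma compact_uncurry (U V W : topologicalType) (f : U -> V -> W) :
  compact [set: V] -> hausdorff_space V ->
  (continuous (f : U -> {compact-open, V -> W})) -> (forall u, continuous (f u)) ->
  continuous (fun x : U * V => f x.1 x.2).
Proof.
move=> cV hV cf cfu.
rewrite (_ : (fun x => _) = uncurry f); last by apply/funext => -[].
apply: continuous_uncurry => //.
move=> v _; exists setT; first exact: filterT.
by split=> //; exact: closedT.
Qed.

Lemma two_cell_continuous (R : realType) (f : Sphere R 3 -> Sphere R 2)
    (V Z : topologicalType) (h : two_cell_space f * V -> Z) :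
  compact [set: V] -> hausdorff_space V ->
  (forall i, continuous (fun x : @piece R i * V =>
     h (\pi_(gquot (attach_rel f)) (existT (@piece R) i x.1), x.2)%qT)) ->
  continuous h.
Proof.
move=> cV hV ch.
have -> : h = (fun x => curry h x.1 x.2) by apply/funext => -[].
apply: compact_uncurry => //.
  apply/(@quotient_continuous _ (gquot (attach_rel f))) => -[i y].
  have [cc _] := continuous_curry (ch i).
  move=> U nU; exact: cc y U nU.
move=> u; rewrite -[u]reprK; case: (repr u) => i y.
have [_ cc] := continuous_curry (ch i).
exact: cc y.
Qed.
End Topology.
(** * Continuous functions and homotopies *)

Section ContinuousFunctions.
Variables (R : realType).

Lemma cont_comp (S T U : topologicalType) (f : S -> T) (g : T -> U) :
  continuous f -> continuous g -> continuous (fun x => g (f x)).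
Proof. by move=> cf cg x; apply: continuous_comp; [exact: cf|exact: cg]. Qed.

Lemma cont_pair (S T U : topologicalType) (f : S -> T) (g : S -> U) :
  continuous f -> continuous g -> continuous (fun x => (f x, g x)).
Proof. by move=> cf cg x; apply: cvg_pair; [exact: cf|exact: cg]. Qed.

Lemma cont_fst (S T U : topologicalType) (f : S -> T * U) :
  continuous f -> continuous (fun x => (f x).1).
Proof. by move=> cf; apply: cont_comp cf _ => x; exact: cvg_fst. Qed.

Lemma cont_snd (S T U : topologicalType) (f : S -> T * U) :
  continuous f -> continuous (fun x => (f x).2).
Proof. by move=> cf; apply: cont_comp cf _ => x; exact: cvg_snd. Qed.

Lemma cont_id (S : topologicalType) : continuous (fun x : S => x).
Proof. by move=> x; exact: cvg_id. Qed.

Variable S : topologicalType.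
Implicit Types f g : S -> R.

Lemma cont_cst (T : topologicalType) (a : T) : continuous (fun _ : S => a).
Proof. by move=> x; exact: cvg_cst. Qed.

Lemma cont_add f g : continuous f -> continuous g -> continuous (fun x => f x + g x).
Proof. by move=> cf cg x; apply: cvgD; [exact: cf|exact: cg]. Qed.

Lemma cont_opp f : continuous f -> continuous (fun x => - f x).
Proof. by move=> cf x; apply: cvgN; exact: cf. Qed.

Lemma cont_sub f g : continuous f -> continuous g -> continuous (fun x => f x - g x).
Proof. by move=> cf cg; apply: cont_add => //; exact: cont_opp. Qed.

Lemma cont_mul f g : continuous f -> continuous g -> continuous (fun x => f x * g x).
Proof. by move=> cf cg x; apply: cvgM; [exact: cf|exact: cg]. Qed.

Lemma cont_sin f : continuous f -> continuous (fun x => sin (f x)).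
Proof. by move=> cf; apply: cont_comp cf _; exact: continuous_sin. Qed.

Lemma cont_cos f : continuous f -> continuous (fun x => cos (f x)).
Proof. by move=> cf; apply: cont_comp cf _; exact: continuous_cos. Qed.

Lemma cont_max f g : continuous f -> continuous g ->
  continuous (fun x => Num.max (f x) (g x)).
Proof. by move=> cf cg x; exact: (@continuous_max _ _ f g x (cf x) (cg x)). Qed.

Lemma cont_min f g : continuous f -> continuous g ->
  continuous (fun x => Num.min (f x) (g x)).
Proof. by move=> cf cg x; exact: (@continuous_min _ _ f g x (cf x) (cg x)). Qed.

Lemma cont_coord n (A : set 'rV[R]_n) (f : S -> set_type A) j :
  continuous f -> continuous (fun x => val (f x) ord0 j).
Proof.
move=> cf; apply: (@cont_comp _ 'rV[R]_n _ (fun x => val (f x))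
  (fun v => v ord0 j)); last first.
  by move=> v; exact: coord_continuous.
by apply: cont_comp cf _; exact: initial_continuous.
Qed.

Lemma cont_set_rV n (A : set 'rV[R]_n) (f : S -> set_type A) :
  (forall j, continuous (fun x => val (f x) ord0 j)) -> continuous f.
Proof. by move=> cf; apply: continuous_to_set_type; exact: continuous_to_rV. Qed.

Lemma cont_val_interval (f : S -> Defs.Interval R) :
  continuous f -> continuous (fun x => val (f x)).
Proof. by move=> cf; apply: cont_comp cf _; exact: initial_continuous. Qed.

Lemma cont_sphere n (f : S -> Sphere R n) :
  (forall j, continuous (fun x => val (f x) ord0 j)) -> continuous f.
Proof. exact: cont_set_rV. Qed.

Lemma cont_sphere_coord n (f : S -> Sphere R n) j :
  continuous f -> continuous (fun x => val (f x) ord0 j).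
Proof. exact: cont_coord. Qed.

End ContinuousFunctions.
Arguments cont_cst {S T} a.
Arguments cont_id {S}.

Section Clamp.
Variable R : realType.

Definition clamp (s : R) : R := Num.max 0 (Num.min 1 s).

Lemma clamp_in s : clamp s \in (`[0, 1]%classic : set R).
Proof.
by apply/mem_set; rewrite /= in_itv /= /clamp le_max lexx /= ge_max ler01 ge_min lexx.
Qed.

Definition clampI (s : R) : Defs.Interval R := exist _ (clamp s) (clamp_in s).

Lemma cont_clampI (S : topologicalType) (f : S -> R) :
  continuous f -> continuous (fun x => clampI (f x)).
Proof.
move=> cf; apply: continuous_to_set_type => /=; rewrite /clamp.
by apply: cont_max (cont_cst _) _; apply: cont_min (cont_cst _) cf.
Qed.

Lemma clamp_le0 s : s <= 0 -> clamp s = 0.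
Proof. by move=> s0; rewrite /clamp max_l // ge_min s0 orbT. Qed.

Lemma clamp_ge1 s : 1 <= s -> clamp s = 1.
Proof. by move=> s1; rewrite /clamp min_l // max_r. Qed.

Lemma clamp_id s : 0 <= s -> s <= 1 -> clamp s = s.
Proof. by move=> s0 s1; rewrite /clamp min_r // max_r. Qed.

Lemma intervalP (t : Defs.Interval R) : 0 <= val t <= 1.
Proof. by have := set_mem (valP t); rewrite /= in_itv. Qed.

Lemma clampI_val (t : Defs.Interval R) : clampI (val t) = t.
Proof. by apply: val_inj => /=; have /andP[t0 t1] := intervalP t; exact: clamp_id. Qed.

Lemma interval_compact : compact [set: Defs.Interval R].
Proof. by apply: set_type_compact; exact: segment_compact. Qed.

Lemma interval_hausdorff : hausdorff_space (Defs.Interval R).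
Proof. by apply: set_type_hausdorff; exact: Rhausdorff. Qed.

End Clamp.

Section Homotopies.
Variable R : realType.

Lemma within_setX (T U Y : topologicalType) (A : set T) (B : set U) (H : T * U -> Y) :
  {within A `*` B, continuous H} ->
  continuous (fun p : set_type A * set_type B => H (val p.1, val p.2)).
Proof.
move=> /subspace_sigL_continuousP cH.
exact: cont_comp (@sigT_of_setX_continuous _ _ A B) cH.
Qed.

(** Prolonging a homotopy to be stationary before time 0 and after time 1 makes
    it continuous on the whole line of times. *)
Lemma homotopic_relP (T Y : topologicalType) (B : set T) (f g : T -> Y) :
  @homotopic_rel R T Y setT B f g <->
  exists2 H : T * R -> Y, continuous H &
    [/\ forall x s, s <= 0 -> H (x, s) = f x, forall x s, 1 <= s -> H (x, s) = g x &
      forall x s, B x -> H (x, s) = f x].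
Proof.
split=> [[H [cH H0 H1 HB]]|[H cH [H0 H1 HB]]].
  exists (fun p => H (p.1, clamp p.2)); last split => [x s s0|x s s1|x s Bx] /=.
  - pose i (x : T) : set_type [set: T] := exist _ x (mem_set I).
    have ci : continuous i by apply: continuous_to_set_type; exact: cont_id.
    apply: (@cont_comp _ (set_type [set: T] * Defs.Interval R)%type _
      (fun p => (i p.1, clampI p.2)) _ _ (within_setX cH)).
    apply: cont_pair; first by apply: cont_comp ci; exact: cont_fst (cont_id).
    by apply: cont_clampI; exact: cont_snd (cont_id).
  - by rewrite clamp_le0 // H0.
  - by rewrite clamp_ge1 // H1.
  - by apply: HB => //; have := set_mem (clamp_in s).
exists H; split=> [|x _|x _|x s Bx _].
- exact: continuous_subspaceT.
- exact: H0.
- exact: H1.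
- exact: HB.
Qed.

Lemma cont_paste (S Y : topologicalType) (f : S -> R) (a : R) (u v : S -> Y) :
  continuous f -> continuous u -> continuous v -> (forall x, f x = a -> u x = v x) ->
  continuous (fun x => if f x <= a then u x else v x).
Proof.
move=> cf cu cv uv; apply/continuous_subspace_setT.
have -> : [set: S] = f @^-1` [set y | y <= a] `|` f @^-1` [set y | a <= y].
  by apply/seteqP; split=> // x _ /=; apply/orP; exact: le_total.
apply: withinU_continuous.
- by apply: (preimage_closed _ (@closed_le _ a)) => x _; exact: cf.
- by apply: (preimage_closed _ (@closed_ge _ a)) => x _; exact: cf.
- apply: subspace_eq_continuous (continuous_subspaceT cu) => x /set_mem /= fa.
  by rewrite /from_subspace fa.
- apply: subspace_eq_continuous (continuous_subspaceT cv) => x /set_mem /= fa.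
  rewrite /from_subspace; case: (leP (f x) a) => // fa'.
  by rewrite uv //; apply/eqP; rewrite eq_le fa fa'.
Qed.

Lemma homotopic_rel_trans (T Y : topologicalType) (B : set T) (f g h : T -> Y) :
  @homotopic_rel R T Y setT B f g -> @homotopic_rel R T Y setT B g h ->
  @homotopic_rel R T Y setT B f h.
Proof.
move=> /homotopic_relP[H cH [H0 H1 HB]] /homotopic_relP[G cG [G0 G1 GB]].
apply/homotopic_relP.
pose F (p : T * R) := if p.2 <= 2^-1 then H (p.1, 2 * p.2) else G (p.1, 2 * p.2 - 1).
have c2 : continuous (fun p : T * R => (p.1, 2 * p.2)).
  apply: cont_pair; first exact: cont_fst (cont_id).
  by apply: cont_mul; [exact: cont_cst|exact: cont_snd (cont_id)].
have c21 : continuous (fun p : T * R => (p.1, 2 * p.2 - 1)).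
  apply: cont_pair; first exact: cont_fst (cont_id).
  by apply: cont_sub (cont_cst _); apply: cont_mul; [exact: cont_cst|exact: cont_snd (cont_id)].
have csnd : continuous (fun p : T * R => p.2) by exact: cont_snd (cont_id).
exists F; last split => [x s s0|x s s1|x s Bx]; rewrite /F /=.
- apply: cont_paste csnd (cont_comp c2 cH) (cont_comp c21 cG) _ => -[x s] /= ->.
  by rewrite mulfV // subrr H1 // G0.
- by rewrite (le_trans s0) ?invr_ge0 // H0 // pmulr_rle0.
- rewrite lt_geF; last by lra.
  by rewrite G1 //; lra.
- by case: leP => _; [exact: HB|rewrite GB // -(H1 x 1) // HB].
Qed.

End Homotopies.
(** * Unit quaternions and the suspension of the 2-sphere *)

Section Quaternions.
Variable R : realType.

Definition coord4 (x : Sphere R 3) (k : nat) : R := val x ord0 (inord k).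

Lemma sphere3_ext (x y : Sphere R 3) :
  coord4 x 0 = coord4 y 0 -> coord4 x 1 = coord4 y 1 ->
  coord4 x 2 = coord4 y 2 -> coord4 x 3 = coord4 y 3 -> x = y.
Proof.
move=> e0 e1 e2 e3; apply: val_inj; apply/rowP => j.
rewrite -[j]inord_val; by case: j => [[|[|[|[|j]]]] j4].
Qed.

Lemma coord4_norm x :
  coord4 x 0 ^+ 2 + coord4 x 1 ^+ 2 + coord4 x 2 ^+ 2 + coord4 x 3 ^+ 2 = 1.
Proof. by rewrite -sum_sqr4; exact: (set_mem (valP x)). Qed.

Definition row4 (a b c d : R) : 'rV[R]_4 := \row_(j < 4) [:: a; b; c; d]`_j.

Lemma row4_in a b c d : a ^+ 2 + b ^+ 2 + c ^+ 2 + d ^+ 2 = 1 ->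
  row4 a b c d \in @sphere_set R 3.
Proof. by move=> n1; apply/mem_set; rewrite /sphere_set /= sum_sqr4 !mxE /= !inordK. Qed.

Definition unit4 a b c d (n1 : a ^+ 2 + b ^+ 2 + c ^+ 2 + d ^+ 2 = 1) : Sphere R 3 :=
  exist _ (row4 a b c d) (row4_in n1).

Lemma unit4E a b c d n1 : let x := @unit4 a b c d n1 in
  [/\ coord4 x 0 = a, coord4 x 1 = b, coord4 x 2 = c & coord4 x 3 = d].
Proof. by rewrite /coord4 /= !mxE !inordK. Qed.

Lemma unit4_0 a b c d n1 : coord4 (@unit4 a b c d n1) 0 = a.
Proof. by case: (unit4E n1). Qed.
Lemma unit4_1 a b c d n1 : coord4 (@unit4 a b c d n1) 1 = b.
Proof. by case: (unit4E n1). Qed.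
Lemma unit4_2 a b c d n1 : coord4 (@unit4 a b c d n1) 2 = c.
Proof. by case: (unit4E n1). Qed.
Lemma unit4_3 a b c d n1 : coord4 (@unit4 a b c d n1) 3 = d.
Proof. by case: (unit4E n1). Qed.
Definition unit4s := (unit4_0, unit4_1, unit4_2, unit4_3).

Lemma cont_unit4 (S : topologicalType) (a b c d : S -> R)
    (n1 : forall x, a x ^+ 2 + b x ^+ 2 + c x ^+ 2 + d x ^+ 2 = 1) :
  continuous a -> continuous b -> continuous c -> continuous d ->
  continuous (fun x => unit4 (n1 x)).
Proof.
move=> ca cb cc cd; apply: cont_sphere => j.
have -> : (fun x => val (unit4 (n1 x)) ord0 j) =
          (fun x => [:: a x; b x; c x; d x]`_j) by apply/funext => x; rewrite mxE.
by case: j => [[|[|[|[|j]]]] j4].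
Qed.

Lemma cont_coord4 (S : topologicalType) (f : S -> Sphere R 3) k :
  continuous f -> continuous (fun x => coord4 (f x) k).
Proof. exact: cont_sphere_coord. Qed.

(** Euler's four-square identity. *)
Lemma qmul_norm x y :
  (coord4 x 0 * coord4 y 0 - coord4 x 1 * coord4 y 1
   - coord4 x 2 * coord4 y 2 - coord4 x 3 * coord4 y 3) ^+ 2 +
  (coord4 x 0 * coord4 y 1 + coord4 x 1 * coord4 y 0
   + coord4 x 2 * coord4 y 3 - coord4 x 3 * coord4 y 2) ^+ 2 +
  (coord4 x 0 * coord4 y 2 - coord4 x 1 * coord4 y 3
   + coord4 x 2 * coord4 y 0 + coord4 x 3 * coord4 y 1) ^+ 2 +
  (coord4 x 0 * coord4 y 3 + coord4 x 1 * coord4 y 2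
   - coord4 x 2 * coord4 y 1 + coord4 x 3 * coord4 y 0) ^+ 2 = 1.
Proof.
rewrite -[RHS]mulr1 -{1}(coord4_norm x) -(coord4_norm y).
ring.
Qed.

(** The multiplication of unit quaternions, with real part first. *)
Definition qmul (x y : Sphere R 3) : Sphere R 3 := unit4 (qmul_norm x y).

Lemma cont_qmul (S : topologicalType) (f g : S -> Sphere R 3) :
  continuous f -> continuous g -> continuous (fun x => qmul (f x) (g x)).
Proof.
move=> cf cg; have mulc k l : continuous (fun x => coord4 (f x) k * coord4 (g x) l).
  by apply: cont_mul; exact: cont_coord4.
by apply: cont_unit4; repeat first [exact: mulc|apply: cont_sub|apply: cont_add].
Qed.

Definition coord3 (y : Sphere R 2) (k : nat) : R := val y ord0 (inord k).

Lemma coord3_norm y : coord3 y 0 ^+ 2 + coord3 y 1 ^+ 2 + coord3 y 2 ^+ 2 = 1.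
Proof.
apply: etrans (set_mem (valP y)).
rewrite !big_ord_recl big_ord0 addr0 addrA /coord3.
by do !congr (_ + _); congr (_ ord0 _ ^+ 2); apply: val_inj; rewrite /= inordK.
Qed.

Lemma suspend_norm y (th : R) :
  sin th ^+ 2 + (cos th * coord3 y 0) ^+ 2 + (cos th * coord3 y 1) ^+ 2 +
  (cos th * coord3 y 2) ^+ 2 = 1.
Proof.
rewrite -(cos2Dsin2 th) -[in RHS](mulr1 (cos th ^+ 2)) -(coord3_norm y); ring.
Qed.

(** The 2-sphere is the set of unit imaginary quaternions [y], and its
    suspension is parametrized by the height angle: [sin th + cos th * y]. *)
Definition suspend (p : Sphere R 2 * R) : Sphere R 3 := unit4 (suspend_norm p.1 p.2).

Lemma cont_suspend : continuous suspend.
Proof.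
apply: cont_unit4; first exact: cont_sin (cont_snd cont_id).
all: apply: cont_mul; first exact: cont_cos (cont_snd cont_id).
all: exact: cont_sphere_coord (cont_fst cont_id).
Qed.

Lemma coord3_antipode y k : coord3 (antipode y) k = - coord3 y k.
Proof. by rewrite /coord3 /= mxE. Qed.

Lemma coord4_antipode x k : coord4 (antipode x) k = - coord4 x k.
Proof. by rewrite /coord4 /= mxE. Qed.

Lemma suspend_antipode y th :
  suspend (antipode y, - th) = antipode (suspend (y, th)).
Proof.
by apply: sphere3_ext; rewrite coord4_antipode !unit4s /= ?sinN ?cosN ?coord3_antipode ?mulrN.
Qed.

(** The conjugate, hence the inverse, of [suspend (v, th)] is
    [suspend (antipode v, th)]. *)
Lemma qmul_conjK v th x : qmul (suspend (v, th)) (qmul (suspend (antipode v, th)) x) = x.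
Proof.
have n1 := suspend_norm v th.
by apply: sphere3_ext; rewrite !unit4s /= !coord3_antipode -[RHS]mul1r -n1; ring.
Qed.

Lemma qmul_conj v th x : qmul x (qmul (suspend (antipode v, th)) (suspend (v, th))) = x.
Proof.
have n1 := suspend_norm v th.
by apply: sphere3_ext; rewrite !unit4s /= !coord3_antipode -[RHS]mul1r -n1; ring.
Qed.

Definition pole (b : bool) : Sphere R 3.
Proof.
by refine (@unit4 (if b then 1 else -1) 0 0 0 _); case: b; ring.
Defined.

Definition angle (b : bool) : R := if b then pi / 2 else - (pi / 2).

Lemma suspend_angle y b : suspend (y, angle b) = pole b.
Proof.
by apply: sphere3_ext; rewrite !unit4s /angle /=; case: b;
  rewrite ?sinN ?cosN ?sin_pihalf ?cos_pihalf ?mul0r.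
Qed.

(** The poles are the central elements 1 and -1. *)
Lemma qmul_pole_conj a b th :
  qmul (suspend (a, th)) (qmul (pole b) (suspend (antipode a, th))) = pole b.
Proof.
have n1 := suspend_norm a th.
by case: b; apply: sphere3_ext; rewrite !unit4s /= !coord3_antipode -[RHS]mul1r -n1; ring.
Qed.

Lemma qmul_poles b : qmul (pole b) (qmul (pole b) (pole b)) = pole b.
Proof. by case: b; apply: sphere3_ext; rewrite !unit4s; ring. Qed.

Lemma qmul_pole1 x : qmul (pole true) (qmul x (pole true)) = x.
Proof. by apply: sphere3_ext; rewrite !unit4s; ring. Qed.

Lemma antipode_pole b : antipode (pole b) = pole (~~ b).
Proof.
by apply: sphere3_ext; rewrite coord4_antipode !unit4s; case: b;
  rewrite /= ?oppr0 ?opprK.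
Qed.

End Quaternions.
(** * The Hopf map and its double after suspension *)

Section HopfSuspension.
Variable R : realType.

Lemma sphere2_ext (x y : Sphere R 2) :
  coord3 x 0 = coord3 y 0 -> coord3 x 1 = coord3 y 1 -> coord3 x 2 = coord3 y 2 ->
  x = y.
Proof.
move=> e0 e1 e2; apply: val_inj; apply/rowP => j.
by rewrite -[j]inord_val; case: j => [[|[|[|j]]] j3].
Qed.

Lemma hopfE (x : Sphere R 3) :
  [/\ coord3 (hopf x) 0 = 2 * (coord4 x 0 * coord4 x 2 + coord4 x 1 * coord4 x 3),
      coord3 (hopf x) 1 = 2 * (coord4 x 1 * coord4 x 2 - coord4 x 0 * coord4 x 3) &
      coord3 (hopf x) 2 =
        coord4 x 0 ^+ 2 + coord4 x 1 ^+ 2 - coord4 x 2 ^+ 2 - coord4 x 3 ^+ 2].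
Proof.
rewrite /coord3 /= !mxE !inordK //= /z1 /z2 /coord4 /=.
by split; ring.
Qed.

Lemma cont_hopf : continuous (@hopf R).
Proof.
have cc (k : nat) : continuous (fun x : Sphere R 3 => coord4 x k).
  exact: cont_coord4 cont_id.
apply: cont_sphere => j.
have -> : (fun x : Sphere R 3 => val (hopf x) ord0 j) = (fun x => coord3 (hopf x) j).
  by apply/funext => x; rewrite /coord3 inord_val.
case: j => [[|[|[|j]]] j3] //=.
- rewrite (_ : (fun x => _) = fun x : Sphere R 3 =>
    2 * (coord4 x 0 * coord4 x 2 + coord4 x 1 * coord4 x 3)); last first.
    by apply/funext => x; case: (hopfE x).
  by apply: cont_mul (cont_cst _) _; apply: cont_add; apply: cont_mul.
- rewrite (_ : (fun x => _) = fun x : Sphere R 3 =>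
    2 * (coord4 x 1 * coord4 x 2 - coord4 x 0 * coord4 x 3)); last first.
    by apply/funext => x; case: (hopfE x).
  by apply: cont_mul (cont_cst _) _; apply: cont_sub; apply: cont_mul.
- rewrite (_ : (fun x => _) = fun x : Sphere R 3 =>
    coord4 x 0 * coord4 x 0 + coord4 x 1 * coord4 x 1 - coord4 x 2 * coord4 x 2
    - coord4 x 3 * coord4 x 3); last first.
    by apply/funext => x; case: (hopfE x) => _ _ ->; rewrite !expr2.
  by apply: cont_sub; [apply: cont_sub; [apply: cont_add|]|]; apply: cont_mul.
Qed.

Lemma turn_norm (phi : R) : cos phi ^+ 2 + 0 ^+ 2 + sin phi ^+ 2 + 0 ^+ 2 = 1.
Proof. by rewrite -(cos2Dsin2 phi); ring. Qed.

Definition turn (phi : R) : Sphere R 3 := unit4 (turn_norm phi).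

Lemma qmul_turn0 x : qmul (turn 0) x = x.
Proof. by apply: sphere3_ext; rewrite !unit4s /= cos0 sin0; ring. Qed.

(** Left multiplication by the quaternion [j], which is [turn (pi / 2)], sends
    each complex line to the orthogonal one, and orthogonal lines are antipodal
    points of the 2-sphere. *)
Lemma hopf_turn_pihalf x : hopf (qmul (turn (pi / 2)) x) = antipode (hopf x).
Proof.
have [e0 e1 e2] := hopfE x; have [f0 f1 f2] := hopfE (qmul (turn (pi / 2)) x).
by apply: sphere2_ext; rewrite coord3_antipode ?f0 ?f1 ?f2 ?e0 ?e1 ?e2
  !unit4s /= cos_pihalf sin_pihalf; ring.
Qed.

Lemma cont_turn (S : topologicalType) (f : S -> R) :
  continuous f -> continuous (fun x => turn (f x)).
Proof.
move=> cf; apply: (@cont_comp _ _ _ f turn) => //.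
apply: cont_unit4; try exact: cont_cst; first exact: continuous_cos.
exact: continuous_sin.
Qed.

Definition apexes : set (Sphere R 3 * R) := [set p | exists b, p.2 = angle R b].

(** The shape of all the homotopies below: [W] is a map of suspension type, and
    only the point that it suspends is moved. *)
Lemma homotopic_family (Y : topologicalType) (W : Y * R -> Sphere R 3)
    (Phi : Sphere R 3 * R -> Y) :
  continuous W -> continuous Phi ->
  (forall y y' b, W (y, angle R b) = W (y', angle R b)) ->
  homotopic_rel R setT apexes (fun p => W (Phi (p.1, 0), p.2))
    (fun p => W (Phi (p.1, 1), p.2)).
Proof.
move=> cW cPhi WB.
exists (fun p => W (Phi (p.1.1, p.2), p.1.2)); split=> //.
- apply: continuous_subspaceT; apply: cont_comp _ cW; apply: cont_pair.
    apply: cont_comp _ cPhi; apply: cont_pair; last exact: cont_snd cont_id.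
    exact: cont_fst (cont_fst cont_id).
  exact: cont_snd (cont_fst cont_id).
- by move=> -[x th] s [b /= ->] _; exact: WB.
Qed.

Definition susp_map (f : Sphere R 3 -> Sphere R 2) (p : Sphere R 3 * R) : Sphere R 3 :=
  suspend (f p.1, p.2).

Lemma susp_map_homotopic (f g : Sphere R 3 -> Sphere R 2) :
  @homotopic_rel R _ _ setT set0 f g ->
  @homotopic_rel R _ _ setT apexes (susp_map f) (susp_map g).
Proof.
move=> /homotopic_relP[H cH [H0 H1 _]].
have -> : susp_map f = fun p => suspend (H (p.1, 0), p.2).
  by apply/funext => p; rewrite H0.
have -> : susp_map g = fun p => suspend (H (p.1, 1), p.2).
  by apply/funext => p; rewrite H1.
apply: homotopic_family => //; first exact: (@cont_suspend R).
by move=> y y' b; rewrite !suspend_angle.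
Qed.

(** The product of two suspended points and, between them, of the inverse of the
    suspension of [v]. *)
Definition triple (v : Sphere R 2) (p : Sphere R 2 * Sphere R 2 * R) : Sphere R 3 :=
  qmul (suspend (p.1.1, p.2))
    (qmul (suspend (antipode v, p.2)) (suspend (p.1.2, p.2))).

Lemma cont_triple v : continuous (triple v).
Proof.
have cth : continuous (fun p : Sphere R 2 * Sphere R 2 * R => p.2) by exact: cont_snd cont_id.
rewrite /triple; apply: cont_qmul; last apply: cont_qmul.
all: apply: cont_comp _ (@cont_suspend R); apply: cont_pair => //.
- exact: cont_fst (cont_fst cont_id).
- exact: cont_cst.
- exact: cont_snd (cont_fst cont_id).
Qed.

Lemma triple_angle v y b : triple v (y, angle R b) = pole R b.
Proof. by rewrite /triple /= !suspend_angle qmul_poles. Qed.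

Lemma triple_hopf_null (v : Sphere R 2) :
  @homotopic_rel R _ _ setT apexes (fun p => triple v (hopf p.1, hopf p.1, p.2))
    (fun p => suspend (antipode v, p.2)).
Proof.
pose conj p := triple v (hopf p.1, antipode (hopf p.1), p.2).
apply: (@homotopic_rel_trans _ _ _ _ _ conj).
  (* turning by [j] replaces the second factor by the inverse of the first *)
  pose Phi (p : Sphere R 3 * R) := (hopf p.1, hopf (qmul (turn (p.2 * (pi / 2))) p.1)).
  have -> : (fun p => triple v (hopf p.1, hopf p.1, p.2)) =
      (fun p => triple v (Phi (p.1, 0), p.2)).
    by apply/funext => p; rewrite /Phi /= mul0r qmul_turn0.
  have -> : conj = (fun p => triple v (Phi (p.1, 1), p.2)).
    by apply/funext => p; rewrite /Phi /= mul1r hopf_turn_pihalf.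
  apply: homotopic_family; first exact: cont_triple.
    apply: cont_pair; first by apply: cont_comp _ cont_hopf; exact: cont_fst cont_id.
    apply: cont_comp _ cont_hopf; apply: cont_qmul; last exact: cont_fst cont_id.
    by apply: cont_turn; apply: cont_mul (cont_cst _); exact: cont_snd cont_id.
  by move=> y y' b; rewrite !triple_angle.
(* the angle of the outer factors moves to the top apex, where they are 1; at
   the apexes the middle factor is central and the outer ones cancel *)
pose W (p : Sphere R 3 * R * R) := let th := (1 - p.1.2) * p.2 + p.1.2 * (pi / 2) in
  qmul (suspend (hopf p.1.1, th))
    (qmul (suspend (antipode v, p.2)) (suspend (antipode (hopf p.1.1), th))).
have -> : conj = (fun p => W (p.1, 0, p.2)).
  by apply/funext => p; rewrite /conj /triple /W /= subr0 mul1r mul0r addr0.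
have -> : (fun p => suspend (antipode v, p.2)) = (fun p => W (p.1, 1, p.2)).
  apply/funext => p; rewrite /W /= subrr mul0r mul1r add0r.
  by rewrite !(suspend_angle _ true) qmul_pole1.
apply: (@homotopic_family _ W id) => //; last 2 first.
- exact: cont_id.
- by move=> y y' b; rewrite /W /= !suspend_angle !qmul_pole_conj.
have cx : continuous (fun p : Sphere R 3 * R * R => hopf p.1.1).
  by apply: cont_comp _ cont_hopf; exact: cont_fst (cont_fst cont_id).
have cth : continuous (fun p : Sphere R 3 * R * R => (1 - p.1.2) * p.2 + p.1.2 * (pi / 2)).
  have c12 : continuous (fun p : Sphere R 3 * R * R => p.1.2) by exact: cont_snd (cont_fst cont_id).
  apply: cont_add; apply: cont_mul => //; last exact: cont_cst.
    by apply: cont_sub => //; exact: cont_cst.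
  exact: cont_snd cont_id.
apply: cont_qmul; last apply: cont_qmul.
all: apply: cont_comp _ (@cont_suspend R); apply: cont_pair => //.
- exact: cont_cst.
- exact: cont_snd cont_id.
- by apply: cont_comp cx _; exact: antipode_continuous.
Qed.

End HopfSuspension.
(** * From the cube to the sphere *)

Section Doubling.
Variable R : realType.

Definition Cube : topologicalType := set_type (@cube R 2).

Lemma cube_compact : compact [set: Cube].
Proof.
apply: set_type_compact.
have := @rV_compact R 3 (fun=> `[0, 1]%classic) (fun=> @segment_compact R 0 1).
by congr compact; apply/seteqP; split.
Qed.

Lemma cubeP (y : Cube) j : 0 <= val y ord0 j <= 1.
Proof. by have := set_mem (valP y) j; rewrite in_itv. Qed.

Section Collapse.
Variables (s0 : Sphere R 3) (q : 'rV[R]_3 -> Sphere R 3).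
Hypothesis qs0 : cube_collapse s0 q.

Lemma cont_collapse : continuous (fun y : Cube => q (val y)).
Proof. by have [cq _ _ _] := qs0; exact/subspace_sigL_continuousP. Qed.

Lemma collapse_bd (y : Cube) : cube_bd (val y) -> q (val y) = s0.
Proof.
by have [_ qbd _ _] := qs0; move=> yb; apply/qbd => //; exact: set_mem (valP y).
Qed.

Lemma collapse_surj x : exists y : Cube, q (val y) = x.
Proof.
have [_ _ _ qsurj] := qs0; have [y cy yx] := qsurj x.
by exists (exist _ y (mem_set cy)).
Qed.

(** The cube times the interval is compact, so that the collapse times the
    identity is a quotient map: a homotopy on the cube that at each time is
    constant on the boundary is a homotopy on the sphere. *)
Lemma collapse_factor (Z : topologicalType) (phi : Cube * Defs.Interval R -> Z) :
  continuous phi ->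
  (forall y y' s, cube_bd (val y) -> cube_bd (val y') -> phi (y, s) = phi (y', s)) ->
  exists2 psi : Sphere R 3 * R -> Z, continuous psi &
    forall y s, psi (q (val y), val s) = phi (y, s).
Proof.
move=> cphi phibd; have [_ qbd qinj _] := qs0.
pose p (x : Cube * Defs.Interval R) := (q (val x.1), x.2).
have [||||||psi cpsi psiE] :=
    @factor_through_closed _ (Sphere R 3 * Defs.Interval R)%type _ p phi.
- rewrite -setXTT; apply: compact_setX; first exact: cube_compact.
  exact: interval_compact.
- apply: hausdorff_prod; last exact: interval_hausdorff.
  by apply: set_type_hausdorff; exact: norm_hausdorff.
- apply: cont_pair; last exact: cont_snd cont_id.
  by apply: cont_comp _ cont_collapse; exact: cont_fst cont_id.
- exact: cphi.
- by move=> [x s]; have [y yx] := collapse_surj x; exists (y, s); rewrite /p yx.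
- move=> [y s] [y' s'] [qy <-] /=.
  have cy := set_mem (valP y); have cy' := set_mem (valP y').
  have [yb|yb] := pselect (cube_bd (val y)).
    by apply: phibd => //; apply/(qbd _ cy'); rewrite -qy; exact/(qbd _ cy).
  have yb' : ~ cube_bd (val y').
    by move=> /(qbd _ cy') qy'; apply: yb; apply/(qbd _ cy); rewrite qy.
  by congr (phi (_, _)); apply: val_inj; exact: qinj.
exists (fun x => psi (x.1, clampI x.2)); last first.
  by move=> y s; rewrite /= clampI_val (psiE (y, s)).
apply: cont_comp _ cpsi; apply: cont_pair; first exact: cont_fst cont_id.
by apply: cont_clampI; exact: cont_snd cont_id.
Qed.

End Collapse.

Lemma stretch_in (a b : R) (y : Cube) :
  (\row_j if j == ord0 then clamp (a * val y ord0 j + b) else val y ord0 j) \in @cube R 2.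
Proof.
apply/mem_set => j; rewrite mxE in_itv /=; case: ifP => _; last exact: cubeP.
by have := set_mem (clamp_in (a * val y ord0 j + b)); rewrite /= in_itv.
Qed.

Definition stretch (a b : R) (y : Cube) : Cube :=
  exist (fun t => t \in @cube R 2) _ (stretch_in a b y).

Lemma stretchE a b y j : val (stretch a b y) ord0 j =
  if j == ord0 then clamp (a * val y ord0 j + b) else val y ord0 j.
Proof. by rewrite /stretch /= mxE. Qed.

Lemma cont_stretch (S : topologicalType) (a b : S -> R) (y : S -> Cube) :
  continuous a -> continuous b -> continuous y ->
  continuous (fun x => stretch (a x) (b x) (y x)).
Proof.
move=> ca cb cy; apply: cont_set_rV => j.
rewrite (_ : (fun x => _) = (fun x => if j == ord0
   then val (clampI (a x * val (y x) ord0 j + b x)) else val (y x) ord0 j)); last first.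
  by apply/funext => x; rewrite stretchE.
have cyj : continuous (fun x => val (y x) ord0 j) by exact: cont_coord.
case: eqP => // _; apply: cont_val_interval; apply: cont_clampI.
by apply: cont_add cb; exact: cont_mul.
Qed.

Lemma stretch_bd a b (y : Cube) : b <= 0 -> 1 <= a + b ->
  cube_bd (val y) -> cube_bd (val (stretch a b y)).
Proof.
move=> b0 ab [_ [j yj]]; split; first exact: set_mem (valP (stretch a b y)).
exists j; rewrite stretchE; case: eqP => // _.
by case: yj => ->; [left; rewrite mulr0 add0r clamp_le0|right; rewrite mulr1 clamp_ge1].
Qed.

Lemma stretch_id (y : Cube) : stretch 1 0 y = y.
Proof.
apply: val_inj; apply/rowP => j; rewrite stretchE mul1r addr0.
by case: eqP => // _; have /andP[? ?] := cubeP y j; exact: clamp_id.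
Qed.

Section Juxtaposition.
Variables (s0 : Sphere R 3) (q : 'rV[R]_3 -> Sphere R 3).
Hypothesis qs0 : cube_collapse s0 q.

Let hopf_stretch (a b : R) (y : Cube) : Sphere R 2 := hopf (q (val (stretch a b y))).

Let hopf_stretch_end (b c : R) (y : Cube) : b <= 0 -> 1 <= 2 + b ->
  clamp (2 * val y ord0 ord0 + b) = c -> c = 0 \/ c = 1 ->
  hopf_stretch 2 b y = hopf s0.
Proof.
move=> b0 b1 cE c01; congr hopf; apply: (collapse_bd qs0).
split; first exact: set_mem (valP (stretch 2 b y)).
by exists ord0; rewrite stretchE eqxx cE.
Qed.

Let row_stretch (b : R) (y : Cube) : 0 <= 2 * val y ord0 ord0 + b <= 1 ->
  \row_i (if i == ord0 then 2 * val y ord0 i + b else val y ord0 i) =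
  val (stretch 2 b y).
Proof.
move=> /andP[? ?]; apply/rowP => j; rewrite mxE stretchE.
by case: eqP => // ->; rewrite clamp_id.
Qed.

(** In a topological group, juxtaposition is a pointwise product: prolong each
    of the two maps by its boundary value to the whole cube; at every point one
    of the two prolongations takes that value, and cancels with the inverse in
    the middle of [triple]. *)
Let suspend_cube_cat (y : Cube) th :
  suspend (cube_cat (hopf \o q) (hopf \o q) (val y), th) =
  triple (hopf s0) (hopf_stretch 2 0 y, hopf_stretch 2 (- 1) y, th).
Proof.
rewrite /cube_cat.
have y01 := cubeP y ord0; case: leP => y2.
  have /andP[h0 h1] : 0 <= 2 * val y ord0 ord0 <= 1 by case/andP: y01 y2; lra.
  rewrite (@hopf_stretch_end (-1) 0); [|lra|lra| |by left].
    rewrite /triple qmul_conj; congr (suspend (hopf (q _), _)).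
    rewrite -row_stretch; last by rewrite addr0 h0.
    by apply/rowP => j; rewrite !mxE addr0.
  by rewrite clamp_le0 // subr_le0.
have /andP[h0 h1] : 0 <= 2 * val y ord0 ord0 - 1 <= 1 by case/andP: y01 y2; lra.
rewrite (@hopf_stretch_end 0 1); [|lra|lra| |by right].
  rewrite /triple qmul_conjK; congr (suspend (hopf (q _), _)).
  by apply: row_stretch; rewrite h0.
by rewrite clamp_ge1 // addr0 -subr_ge0.
Qed.

(** The two prolongations are then stretched until each of them is the
    whole map. *)
Lemma cube_cat_triple : exists P : Sphere R 3 * R -> Sphere R 2 * Sphere R 2,
  [/\ continuous P, forall x, P (x, 1) = (hopf x, hopf x) &
    forall (y : Cube) th,
      suspend (cube_cat (hopf \o q) (hopf \o q) (val y), th) =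
      triple (hopf s0) (P (q (val y), 0), th)].
Proof.
pose phi (x : Cube * Defs.Interval R) :=
  (hopf_stretch (2 - val x.2) 0 x.1, hopf_stretch (2 - val x.2) (val x.2 - 1) x.1).
have [||P cP PE] := @collapse_factor s0 q qs0 _ phi.
- have cs : continuous (fun x : Cube * Defs.Interval R => val x.2).
    by apply: cont_val_interval; exact: cont_snd cont_id.
  have cx : continuous (fun x : Cube * Defs.Interval R => x.1).
    exact: cont_fst cont_id.
  apply: cont_pair; apply: cont_comp _ (@cont_hopf R);
    apply: cont_comp _ (cont_collapse qs0); apply: cont_stretch => //;
    by [exact: cont_cst|apply: cont_sub => //; exact: cont_cst].
- move=> y y' s yb yb'; have := intervalP s.
  rewrite /phi [_.2]/= [_.1]/= /hopf_stretch; move: (val s) => t /andP[t0 t1].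
  have a1 : 1 <= 2 - t + 0 by lra.
  have b0 : t - 1 <= 0 by lra.
  have b1 : 1 <= 2 - t + (t - 1) by lra.
  by congr (hopf _, hopf _); rewrite !(collapse_bd qs0) //; exact: stretch_bd.
have v0 : val (clampI (0 : R)) = 0 by rewrite /= clamp_le0.
have v1 : val (clampI (1 : R)) = 1 by rewrite /= clamp_ge1.
exists P; split=> // [x|y th].
  have [y <-] := collapse_surj qs0 x; have := PE y (clampI 1).
  rewrite /phi [_.2]/= [_.1]/= v1 subrr (_ : 2 - 1 = 1); last by ring.
  by rewrite /hopf_stretch stretch_id.
rewrite suspend_cube_cat; have := PE y (clampI 0).
by rewrite /phi [_.2]/= [_.1]/= v0 subr0 sub0r => ->.
Qed.

End Juxtaposition.

Lemma represents_twice_hopf (f : Sphere R 3 -> Sphere R 2) :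
  represents_twice hopf f ->
  exists v, homotopic_rel R setT (@apexes R) (susp_map f)
    (fun p => triple v (hopf p.1, hopf p.1, p.2)).
Proof.
move=> [s0 [q [g [qs0 cg fg gs0 [H [cH H0 H1 Hbd]]]]]]; exists (hopf s0).
have v0 : val (clampI (0 : R)) = 0 by rewrite /= clamp_le0.
have v1 : val (clampI (1 : R)) = 1 by rewrite /= clamp_ge1.
apply: homotopic_rel_trans (susp_map_homotopic fg) _.
have [y y' s yb yb'|K cK KE] := collapse_factor qs0 (within_setX cH).
  have sI := set_mem (valP s).
  by rewrite !Hbd //= !(collapse_bd qs0).
have K0 x : K (x, 0) = g x.
  have [y <-] := collapse_surj qs0 x.
  have : K (q (val y), val (clampI 0)) = H (val y, val (clampI 0)) := KE _ _.
  by rewrite v0 H0 //; exact: set_mem (valP y).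
have K1 (y : Cube) : K (q (val y), 1) = cube_cat (hopf \o q) (hopf \o q) (val y).
  have : K (q (val y), val (clampI 1)) = H (val y, val (clampI 1)) := KE _ _.
  by rewrite v1 H1 //; exact: set_mem (valP y).
have [P [cP P1 P0]] := cube_cat_triple qs0.
have -> : susp_map g = (fun p => suspend (K (p.1, 0), p.2)).
  by apply/funext => -[x th]; rewrite K0.
apply: (@homotopic_rel_trans _ _ _ _ _ (fun p => suspend (K (p.1, 1), p.2))).
  apply: (@homotopic_family R _ (@suspend R) K) => //; first exact: cont_suspend.
  by move=> y y' b; rewrite !suspend_angle.
have -> : (fun p => suspend (K (p.1, 1), p.2)) =
    (fun p => triple (hopf s0) (P (p.1, 0), p.2)).
  apply/funext => -[x th] /=; have [y <-] := collapse_surj qs0 x.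
  by rewrite K1 P0.
have -> : (fun p => triple (hopf s0) (hopf p.1, hopf p.1, p.2)) =
    (fun p => triple (hopf s0) (P (p.1, 1), p.2)).
  by apply/funext => -[x th]; rewrite P1.
apply: homotopic_family => //; first exact: cont_triple.
by move=> y y' b; rewrite !triple_angle.
Qed.

Lemma susp_twice_hopf_null (f : Sphere R 3 -> Sphere R 2) :
  represents_twice hopf f ->
  exists v, homotopic_rel R setT (@apexes R) (susp_map f) (fun p => suspend (v, p.2)).
Proof.
move=> /represents_twice_hopf[v fv]; exists (antipode v).
exact: homotopic_rel_trans fv (triple_hopf_null v).
Qed.

End Doubling.
(** * The map from the suspension to the 3-sphere *)

Section UpperBound.
Variable R : realType.

Lemma sphere3_compact : compact [set: Sphere R 3].
Proof.
apply: set_type_compact.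
have cbox := @rV_compact R 4 (fun=> `[-1, 1]%classic) (fun=> @segment_compact R (-1) 1).
apply: subclosed_compact cbox _.
  have -> : @sphere_set R 3 = (fun v : 'rV[R]_4 => \sum_i v ord0 i ^+ 2) @^-1` [set 1] by [].
  apply: preimage_closed; last exact: closed_eq.
  move=> v _; rewrite (_ : (fun v : 'rV[R]_4 => _) = fun v : 'rV[R]_4 =>
    v ord0 (inord 0) * v ord0 (inord 0) + v ord0 (inord 1) * v ord0 (inord 1) +
    v ord0 (inord 2) * v ord0 (inord 2) + v ord0 (inord 3) * v ord0 (inord 3)); last first.
    by apply/funext => u; rewrite sum_sqr4 !expr2.
  have cc (k : 'I_4) : continuous (fun v : 'rV[R]_4 => v ord0 k) by exact: coord_continuous.
  move: v; apply: cont_add; [apply: cont_add; [apply: cont_add|]|]; exact: cont_mul.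
move=> v; rewrite /sphere_set /= => v1 i; rewrite in_itv /= -ler_norml.
rewrite -(@expr_le1 _ 2) // real_normK ?num_real // -v1 (bigD1 i) //= lerDl.
by apply: sumr_ge0 => j _; exact: sqr_ge0.
Qed.

(** The suspension coordinate before gluing: a side, and the distance to the
    equator.  The two points at distance 0 are distinct but have the same angle,
    whence the third clause of [extend_to_disk]. *)
Definition Height := (two_points * Defs.Interval R)%type.

Definition height_angle (v : Height) : R :=
  if v.1 then val v.2 * (pi / 2) else - (val v.2 * (pi / 2)).

Lemma cont_height_angle : continuous height_angle.
Proof.
have c1 : continuous (fun t : Defs.Interval R => val t * (pi / 2)).
  by apply: cont_mul (cont_cst _); exact: cont_val_interval cont_id.
have cS : continuous (fun p : bool * R => if p.1 then p.2 else - p.2).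
  move=> [b t]; apply/cvgrPdist_lt => e e0.
  exists ([set b], ball t e); first split => /=.
  - exact: discrete_set1.
  - exact: nbhsx_ballx.
  by move=> [b' t'] /= [-> tt']; case: b => //; rewrite -opprD normrN.
apply: (@cont_comp _ (bool * R)%type _ (fun v : Height => (v.1, val v.2 * (pi / 2))) _ _ cS).
apply: cont_pair; first exact: cont_fst cont_id.
by apply: cont_comp _ c1; exact: cont_snd cont_id.
Qed.

Lemma height_compact : compact [set: Height].
Proof.
rewrite -setXTT; apply: compact_setX; first exact: bool_compact.
exact: interval_compact.
Qed.

Lemma height_hausdorff : hausdorff_space Height.
Proof. by apply: hausdorff_prod; [exact: discrete_hausdorff|exact: interval_hausdorff]. Qed.

Definition flip (v : Height) : Height := (~~ v.1, v.2).

Lemma height_angle_flip v : height_angle (flip v) = - height_angle v.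
Proof. by case: v => [[] t]; rewrite /height_angle /= ?opprK. Qed.

Lemma height_angle1 v : val v.2 = 1 -> height_angle v = angle R v.1.
Proof. by rewrite /height_angle /angle => ->; rewrite mul1r. Qed.

Lemma height_angle0 v : val v.2 = 0 -> height_angle v = 0.
Proof. by rewrite /height_angle => ->; rewrite mul0r oppr0 if_same. Qed.

Lemma cone_norm (x : Sphere R 3) (s : Defs.Interval R) :
  \sum_i ((1 - val s) *: val x) ord0 i ^+ 2 = (1 - val s) ^+ 2.
Proof.
under eq_bigr => i _ do rewrite mxE exprMn.
by rewrite -mulr_sumr (set_mem (valP x)) mulr1.
Qed.

Lemma cone_in (x : Sphere R 3) (s : Defs.Interval R) :
  (1 - val s) *: val x \in [set z : 'rV[R]_4 | \sum_i z ord0 i ^+ 2 <= 1].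
Proof.
apply/mem_set; rewrite /= cone_norm.
by have /andP[s0 s1] := intervalP s; rewrite expr_le1 //; lra.
Qed.

(** The 4-ball is the cone over the 3-sphere; at [s = 0] one is on the boundary
    and at [s = 1] at the centre. *)
Definition cone (x : Sphere R 3) (s : Defs.Interval R) : Disk R 4 :=
  exist (fun z => z \in [set z : 'rV[R]_4 | \sum_i z ord0 i ^+ 2 <= 1]) _ (cone_in x s).

Lemma cone_surj (z : Disk R 4) : exists x s, cone x s = z.
Proof.
have := set_mem (valP z); rewrite /= => z1.
pose r := Num.sqrt (\sum_i val z ord0 i ^+ 2).
have r2 : r ^+ 2 = \sum_i val z ord0 i ^+ 2.
  by rewrite sqr_sqrtr // sumr_ge0 // => i _; exact: sqr_ge0.
have r0 : 0 <= r by exact: sqrtr_ge0.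
have r1 : r <= 1 by rewrite -(@expr_le1 _ 2) // r2.
have [rz|rz] := eqVneq r 0.
  exists (pole R true), (clampI 1); apply: val_inj => /=.
  rewrite clamp_ge1 // subrr scale0r; apply/rowP => i; rewrite mxE.
  have : \sum_i val z ord0 i ^+ 2 = 0 by rewrite -r2 rz expr0n.
  move/eqP; rewrite psumr_eq0; last by move=> j _; exact: sqr_ge0.
  by move/allP => /(_ i (mem_index_enum _)) /=; rewrite sqrf_eq0 => /eqP ->.
have xS : r^-1 *: val z \in @sphere_set R 3.
  apply/mem_set; rewrite /sphere_set /=; under eq_bigr => i _ do rewrite mxE exprMn.
  by rewrite -mulr_sumr -r2 -exprMn mulVf // expr1n.
exists (exist (fun u => u \in @sphere_set R 3) _ xS), (clampI (1 - r)); apply: val_inj => /=.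
by rewrite clamp_id ?subKr ?scalerA ?mulfV ?scale1r //; lra.
Qed.

Lemma cone_inj x s x' s' : cone x s = cone x' s' -> s = s' /\ (val s = 1 \/ x = x').
Proof.
move=> /(congr1 val) /= E.
have ss' : s = s'.
  apply: val_inj; have := cone_norm x s; rewrite E cone_norm => /eqP.
  have /andP[_ s1] := intervalP s; have /andP[_ s1'] := intervalP s'.
  by rewrite eqrXn2 ?subr_ge0 // => /eqP; move: s1 s1' => /=; lra.
split=> //; have [s1|s1] := eqVneq (val s) 1; [by left|right].
apply: val_inj; move: E; rewrite -ss' => /scalerI; apply.
by rewrite subr_eq0 eq_sym.
Qed.

Lemma cone0 x s : val s = 0 -> cone x s = sphere_disk x.
Proof. by move=> s0; apply: val_inj; rewrite /= s0 subr0 scale1r. Qed.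

Lemma cont_cone : continuous (fun p : Sphere R 3 * Defs.Interval R => cone p.1 p.2).
Proof.
apply: cont_set_rV => j.
rewrite (_ : (fun x => _) = (fun p : Sphere R 3 * Defs.Interval R =>
    (1 - val p.2) * val p.1 ord0 j));
  last by apply/funext => p; rewrite /= mxE.
apply: cont_mul; last exact: cont_sphere_coord (cont_fst cont_id).
by apply: cont_sub (cont_cst _) _; apply: cont_val_interval; exact: cont_snd cont_id.
Qed.

Variable f : Sphere R 3 -> Sphere R 2.
Variables (v0 : Sphere R 2).
Hypothesis f_null : homotopic_rel R setT (@apexes R) (susp_map f) (fun p => suspend (v0, p.2)).

(** The homotopy fills the cone: it runs along the radii and no longer depends on
    the direction at the centre. *)
Lemma extend_to_disk : exists K : Disk R 4 * Height -> Sphere R 3,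
  [/\ continuous K,
      forall x v, K (sphere_disk x, v) = suspend (f x, height_angle v),
      forall z v w, height_angle v = height_angle w -> K (z, v) = K (z, w) &
      forall z v, val v.2 = 1 -> K (z, v) = pole R v.1].
Proof.
have /homotopic_relP[H cH [H0 H1 HB]] := f_null.
pose A := (Sphere R 3 * Defs.Interval R * Height)%type.
pose p (a : A) : Disk R 4 * Height := (cone a.1.1 a.1.2, a.2).
pose phi (a : A) := H (a.1.1, height_angle a.2, val a.1.2).
have [||||||K cK KE] := @factor_through_closed A (Disk R 4 * Height)%type _ p phi.
- rewrite -setXTT; apply: compact_setX; last exact: height_compact.
  by rewrite -setXTT; apply: compact_setX; [exact: sphere3_compact|exact: interval_compact].
- apply: hausdorff_prod; last exact: height_hausdorff.
  by apply: set_type_hausdorff; exact: norm_hausdorff.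
- apply: cont_pair; last exact: cont_snd cont_id.
  by apply: cont_comp _ cont_cone; exact: cont_fst cont_id.
- apply: cont_comp _ cH; apply: cont_pair.
    apply: cont_pair; first exact: cont_fst (cont_fst cont_id).
    by apply: cont_comp _ cont_height_angle; exact: cont_snd cont_id.
  by apply: cont_val_interval; exact: cont_snd (cont_fst cont_id).
- by move=> [z v]; have [x [s <-]] := cone_surj z; exists (x, s, v).
- move=> [[x s] v] [[x' s'] v'] E; have /cone_inj[ss' sx] := congr1 fst E.
  have /= vv' := congr1 snd E; rewrite /phi -vv' -ss' /=.
  by case: sx => [/= s1|/= -> //]; rewrite !H1 ?s1.
exists K; split=> // [x v|z v w vw|z v v1].
- have s0 : val (clampI (0 : R)) = 0 by rewrite /= clamp_le0.
  by rewrite -(cone0 x s0) (KE (x, clampI 0, v)) /phi H0 ?s0.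
- by have [x [s <-]] := cone_surj z; rewrite (KE (x, s, v)) (KE (x, s, w)) /phi /= vw.
- have [x [s <-]] := cone_surj z; rewrite (KE (x, s, v)) /phi HB; last first.
    by exists v.1; exact: height_angle1.
  by rewrite /susp_map /= height_angle1 // suspend_angle.
Qed.

(** On the second cell equivariance leaves no choice, and the value there agrees
    with the attaching map because the two attaching maps are antipodal. *)
Lemma susp_index_le3 : exists g : susp R (two_cell_space f) -> Sphere_Z2 R 3, Z2map g.
Proof.
have [K [cK Kf Kangle Kpole]] := extend_to_disk.
pose G (p : {i & @piece R i}) (v : Height) : Sphere R 3 :=
  match p with
  | existT None y => suspend (y, height_angle v)
  | existT (Some b) z => if b then antipode (K (z, flip v)) else K (z, v)
  end.
have Gr v p q : attach_rel f p q -> G p v = G q v.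
  move=> [b [x [-> ->]]] /=; rewrite /attaching_map; case: b; rewrite Kf //.
  by rewrite height_angle_flip -suspend_antipode opprK.
have Gangle p v w : height_angle v = height_angle w -> G p v = G p w.
  move=> vw; case: p => -[[]|] y /=; last by rewrite vw.
    by congr antipode; apply: Kangle; rewrite !height_angle_flip vw.
  exact: Kangle.
have Gpole p v : val v.2 = 1 -> G p v = pole R v.1.
  move=> v1; case: p => -[[]|] y /=; last by rewrite height_angle1 // suspend_angle.
    by rewrite Kpole //= antipode_pole negbK.
  exact: Kpole.
have Ginv p v : G (piece_inv p) (flip v) = antipode (G p v).
  have flipK : flip (flip v) = v by case: (v) => b t; rewrite /flip /= negbK.
  case: p => -[[]|] y /=; last by rewrite height_angle_flip suspend_antipode.
    by rewrite antipodeK.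
  by rewrite flipK.
pose Psi (x : two_cell_space f * Height) := G (repr x.1) x.2.
have PsiE p v : Psi (\pi_(gquot (attach_rel f)) p, v)%qT = G p v.
  rewrite /Psi /=; apply: (@gquot_ind _ (attach_rel f) _ (G ^~ v)); last by rewrite reprK.
  by move=> a b; exact: Gr.
have cPsi : continuous Psi.
  apply: two_cell_continuous; [exact: height_compact|exact: height_hausdorff|].
  move=> i; rewrite (_ : (fun x => _) = (fun x => G (existT (@piece R) i x.1) x.2)); last first.
    by apply/funext => x; rewrite PsiE.
  have cflip : continuous flip.
    apply: cont_pair; last exact: cont_snd cont_id.
    by apply: cont_comp _ negb_continuous; exact: cont_fst cont_id.
  case: i => [[]|] /=.
  - apply: (@cont_comp _ _ _ _ (@antipode R 3)); last exact: antipode_continuous.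
    apply: cont_comp _ cK; apply: cont_pair; first exact: cont_fst cont_id.
    by apply: cont_comp _ cflip; exact: cont_snd cont_id.
  - by apply: cont_comp _ cK; apply: cont_pair; [exact: cont_fst cont_id|exact: cont_snd cont_id].
  - apply: cont_comp _ (@cont_suspend R); apply: cont_pair; first exact: cont_fst cont_id.
    by apply: cont_comp _ cont_height_angle; exact: cont_snd cont_id.
have PsiI x v : Psi (z2_inv x, flip v) = antipode (Psi (x, v)).
  rewrite -[x]reprK (PsiE (repr x) v) -Ginv -PsiE; congr (Psi (_, _)).
  exact: (gquot_mapE (@piece_inv_rel R f)).
pose F (w : two_cell_space f * two_points * Defs.Interval R) := Psi (w.1.1, (w.1.2, w.2)).
have Fr w w' : join_rel w w' -> F w = F w'.
  move: w w' => [[x b] t] [[x' b'] t'].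
  case=> -[/= t0 t0' e]; rewrite /F /Psi /=.
    by rewrite -e; apply: Gangle; rewrite !height_angle0.
  by rewrite !Gpole //= e.
pose J := gquot (@join_rel R (two_cell_space f) two_points).
pose g (w : susp R (two_cell_space f)) := F (repr (w : J)).
have gE w : g (\pi_J w)%qT = F w.
  rewrite /g; apply: (@gquot_ind _ (@join_rel R (two_cell_space f) two_points)).
    exact: Fr.
  by rewrite reprK.
exists g; split.
  apply/(@quotient_continuous _ J).
  rewrite (_ : _ \o _ = F); last by apply/funext => w /=; exact: gE.
  apply: cont_comp _ cPsi; apply: cont_pair; first exact: cont_fst (cont_fst cont_id).
  by apply: cont_pair; [exact: cont_snd (cont_fst cont_id)|exact: cont_snd cont_id].
move=> w; have -> : w = (\pi_J (repr (w : J)))%qT by rewrite reprK.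
case: (repr (w : J)) => -[x b] t.
have -> : @z2_inv (susp R (two_cell_space f)) (\pi_J (x, b, t))%qT =
    (\pi_J (join_inv (x, b, t)))%qT.
  exact: (gquot_mapE (@join_inv_rel R (two_cell_space f) two_points)).
rewrite !gE; exact: PsiI x (b, t).
Qed.

End UpperBound.
(** * The lower bound and the index *)

Section LowerBound.
Variable R : realType.

Lemma sphere_point_in (s t : R) :
  (\row_(j < 3) [:: cos (s * pi); sin (s * pi) * cos (t * pi); sin (s * pi) * sin (t * pi)]`_j)
    \in @sphere_set R 2.
Proof.
apply/mem_set; rewrite /sphere_set /= !big_ord_recl big_ord0 !mxE /= addr0.
by rewrite !exprMn -mulrDr cos2Dsin2 mulr1 cos2Dsin2.
Qed.

(** Latitude and longitude, in units of half a turn. *)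
Definition sphere_point (p : R * R) : Sphere R 2 :=
  exist (fun u => u \in @sphere_set R 2) _ (sphere_point_in p.1 p.2).

Lemma cont_sphere_point : continuous sphere_point.
Proof.
apply: cont_sphere => j.
rewrite (_ : (fun x => _) = (fun p : R * R => [:: cos (p.1 * pi);
  sin (p.1 * pi) * cos (p.2 * pi); sin (p.1 * pi) * sin (p.2 * pi)]`_j)); last first.
  by apply/funext => p; rewrite /= mxE.
have c1 : continuous (fun p : R * R => p.1 * pi).
  by apply: cont_mul (cont_cst _); exact: cont_fst cont_id.
have c2 : continuous (fun p : R * R => p.2 * pi).
  by apply: cont_mul (cont_cst _); exact: cont_snd cont_id.
by case: j => [[|[|[|j]]] j3] //=; [exact: cont_cos| |];
  apply: cont_mul; (exact: cont_sin || exact: cont_cos).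
Qed.

Lemma sphere_point_eq (s t s' t' : R) :
  cos (s * pi) = cos (s' * pi) ->
  sin (s * pi) * cos (t * pi) = sin (s' * pi) * cos (t' * pi) ->
  sin (s * pi) * sin (t * pi) = sin (s' * pi) * sin (t' * pi) ->
  sphere_point (s, t) = sphere_point (s', t').
Proof. by move=> e0 e1 e2; apply: val_inj => /=; rewrite e0 e1 e2. Qed.

Lemma sphere_point_opp (s t : R) :
  sphere_point (s, 1 + t) = antipode (sphere_point (1 - s, t)).
Proof.
apply: val_inj; apply/rowP => j; rewrite /= !mxE /=.
have cE : cos ((1 - s) * pi) = - cos (s * pi).
  by rewrite mulrBl mul1r cosB cospi sinpi mul0r addr0 mulN1r.
have sE : sin ((1 - s) * pi) = sin (s * pi).
  by rewrite mulrBl mul1r sinB cospi sinpi mul0r sub0r mulN1r opprK.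
rewrite cE sE mulrDl mul1r addrC cosDpi sinDpi.
by case: j => [[|[|[|j]]] j3] //=; rewrite ?opprK ?mulrN.
Qed.

Definition coord_index (c : option bool) : nat :=
  if c is Some b then if b then 2%N else 1%N else 0%N.

Lemma pad_unit_vec3 (n : nat) (x : Sphere R n) : (n <= 2)%N ->
  unit_vec3 (fun c => if (coord_index c <= n)%N
    then val x ord0 (inord (coord_index c)) else 0).
Proof.
move=> n2; rewrite /unit_vec3 /=; have := set_mem (valP x); rewrite /sphere_set /=.
move: (sval x) => w {x}; move: n2 w; case: n => [|[|[|//]]] _ w /=;
  rewrite !big_ord_recl big_ord0 /= addr0 => <-; rewrite ?expr0n /= ?addr0 ?addrA;
  by do ?congr (_ + _); congr (w _ _ ^+ 2); apply: val_inj; rewrite /= inordK.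
Qed.

Variables (f : Sphere R 3 -> Sphere R 2).
Local Notation X := (two_cell_space f).

(** The half of the suspended 2-sphere that contains the apex [true] is a
    homotopy from an odd map to a constant one.  A target of dimension less than
    2 is enlarged by zero coordinates. *)
Lemma susp_index_ge3 (n : nat) (g : susp R X -> Sphere_Z2 R n) : Z2map g -> (2 < n)%N.
Proof.
move=> [cg godd]; rewrite ltnNge; apply/negP => n2.
pose base (y : Sphere R 2) : X := (\pi_(gquot (attach_rel f)) (existT (@piece R) None y))%qT.
pose J := gquot (@join_rel R X two_points).
pose P (y : Sphere R 2) (u : R) : susp R X := (\pi_J (base y, true, clampI u))%qT.
pose G (y : Sphere R 2) (u : R) : Sphere R n := g (P y u).
have cG : continuous (fun p : Sphere R 2 * R => G p.1 p.2).
  apply: (@cont_comp _ (susp R X) _ (fun p => P p.1 p.2) g) => //.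
  apply: cont_comp _ (@pi_continuous _ J); apply: cont_pair.
    apply: cont_pair; last exact: cont_cst.
    apply: (@cont_comp _ _ _ _ base); first exact: cont_fst cont_id.
    apply: cont_comp _ (@pi_continuous _ (gquot (attach_rel f))).
    move=> y U; exact: (@existT_continuous _ (@piece R) None y U).
  by apply: cont_clampI; exact: cont_snd cont_id.
have G1 y y' : G y 1 = G y' 1.
  rewrite /G; congr g; apply: gquot_eq; right; split=> //=; exact: clamp_ge1.
have G0 y : G (antipode y) 0 = antipode (G y 0).
  transitivity (@z2_inv (Sphere_Z2 R n) (G y 0)); last by [].
  rewrite /G -godd; congr g.
  have -> : @z2_inv (susp R X) (P y 0) =
      (\pi_J (@join_inv R X two_points (base y, true, clampI 0)))%qT.
    exact: (gquot_mapE (@join_inv_rel R X two_points)).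
  have yE : @z2_inv X (base y) = base (antipode y).
    exact: (gquot_mapE (@piece_inv_rel R f)).
  have -> : @join_inv R X two_points (base y, true, clampI 0) =
      (base (antipode y), false, clampI 0) by rewrite -yE.
  apply: gquot_eq; left; split=> //=; exact: clamp_le0.
pose h (c : option bool) (p : R * R * R) : R :=
  if (coord_index c <= n)%N
  then val (G (sphere_point p.1) p.2) ord0 (inord (coord_index c)) else 0.
apply: (@odd_not_contractible R h).
- move=> c; rewrite /h; case: (coord_index c <= n)%N; last exact: cont_cst.
  apply: cont_sphere_coord.
  apply: (@cont_comp _ (Sphere R 2 * R)%type _
    (fun p : R * R * R => (sphere_point p.1, p.2)) _ _ cG).
  apply: cont_pair; last exact: cont_snd cont_id.
  by apply: cont_comp _ cont_sphere_point; exact: cont_fst cont_id.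
- by move=> p; exact: pad_unit_vec3.
- by move=> c t u; rewrite /h /= (@sphere_point_eq 0 t 0 0) // mul0r sin0 ?mul0r.
- by move=> c t u; rewrite /h /= (@sphere_point_eq 1 t 1 0) // mul1r sinpi ?mul0r.
- move=> c s u; rewrite /h /= (@sphere_point_eq s 2 s 0) // mul0r -[2 * pi]/(2 * pi).
    by rewrite mulr_natl cos2pi cos0.
  by rewrite mulr_natl sin2pi sin0.
- by move=> c s t; rewrite /h /= (G1 _ (sphere_point (0, 0))).
- move=> c s t; rewrite /h /= sphere_point_opp G0; case: ifP => _; last by rewrite oppr0.
  by rewrite /= mxE.
Qed.

End LowerBound.

Theorem lemma19 (R : realType) (twice_h : Sphere R 3 -> Sphere R 2) :
  continuous twice_h ->
  represents_twice hopf twice_h ->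
  z2_index R (susp R (two_cell_space twice_h)) = Some 3.
Proof.
move=> _ /susp_twice_hopf_null[v null].
have [g gZ2] := susp_index_le3 null.
rewrite /z2_index; case: pselect => [ex|[]]; last first.
  by exists 3; apply/asboolP; exists g.
congr Some; case: ex_minnP => m /asboolP[g' g'Z2] mmin.
apply/eqP; rewrite eqn_leq (susp_index_ge3 g'Z2) andbT.
by apply: mmin; apply/asboolP; exists g.
Qed.
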